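(* Let $\mathcal{T}$ be a regular continuity type on $\mathsf{Ab(Top)}$ with associated closure operator $\mathfrak{f}$. The assignment $$\mathfrak{f}\colon \mathsf{Pr}_{\mathcal{T}}\mathsf{Ab}\longrightarrow \mathcal{T}\mathsf{kPrAb},\qquad (A,\tau_H)\longmapsto (A,\tau_{\mathfrak{f}_K(H)})\quad (K=\hat A,\ H\leq K),$$ sending a $\mathcal{T}$-continuous homomorphism $\varphi\colon (A,\tau_H)\to(B,\tau_L)$ to the same underlying homomorphism $\mathfrak{f}\varphi=\varphi\colon (A,\tau_{\mathfrak{f}_K(H)})\to (B,\tau_{\mathfrak{f}_C(L)})$ (where $C=\hat B$), is a functor. Furthermore: (a) $\mathfrak{f}\colon \mathsf{Pr}_{\mathcal{T}}\mathsf{Ab}\to\mathcal{T}\mathsf{kPrAb}$ is an equivalence of categories; (b) $\mathfrak{f}\colon \mathsf{PrAb}\to\mathcal{T}\mathsf{kPrAb}$ (the restriction to $\mathsf{PrAb}$ of the functor $\mathfrak{f}\colon \mathsf{Pr}_{\mathcal{T}}\mathsf{Ab}\to\mathcal{T}\mathsf{kPrAb}$, $(A,\tau_H)\mapsto (A,\tau_{\mathfrak{f}_K(H)})$, $\varphi\mapsto\mathfrak{f}\varphi=\varphi$) is a coreflection, i.e. it is right adjoint to the inclusion $\mathcal{T}\mathsf{kPrAb}\to\mathsf{PrAb}$.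
   Context: $\mathbb{T}=\mathbb{R}/\mathbb{Z}$. $\mathsf{Ab(Top)}$ is the category of abelian topological groups (no separation axioms) and continuous homomorphisms; $\hat G$ is the Pontryagin dual of $G$, and a continuous homomorphism $\varphi\colon G_1\to G_2$ induces $\hat\varphi\colon\hat G_2\to\hat G_1$, $\hat\varphi(x)=x\circ\varphi$. For a filter-base $\mathcal{F}$ and a map $\varphi$, $\varphi(\mathcal{F})=\{\varphi(F)\mid F\in\mathcal{F}\}$. A continuity type $\mathcal{T}$ on $\mathsf{Ab(Top)}$ assigns to each $G\in\mathsf{Ab(Top)}$ a collection $\mathcal{T}(G)$ of filter-bases on $G$ such that $\varphi(\mathcal{F})\in\mathcal{T}(G_2)$ for every continuous homomorphism $\varphi\colon G_1\to G_2$ and every $\mathcal{F}\in\mathcal{T}(G_1)$. It is regular if $\mathcal{T}(G)=\mathcal{T}(G_d)$ for every $G\in\mathsf{Ab(Top)}$, where $G_d$ is $G$ with the discrete topology. For a filter-base $\mathcal{F}$ on $\hat G$, put $z_{\mathcal{F}}(G)=\{\chi\in G\mid \chi(\mathcal{F})\longrightarrow 0\text{ in }\mathbb{T}\}$, where $\chi\in G$ is regarded as the character $x\mapsto x(\chi)$ of $\hat G$. The closure operator $\mathfrak{f}$ associated with $\mathcal{T}$ is given, for $H\leq G$, by $$\mathfrak{f}_G(H)=\bigcap\{z_{\mathcal{F}}(G)\mid \mathcal{F}\in\mathcal{T}(\hat G),\ H\leq z_{\mathcal{F}}(G)\}$$ (the empty intersection being $G$). A homomorphism $\varphi\colon G_1\to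 G_2$ (not necessarily continuous), where $G_1\in\mathsf{Ab(Top)}$ and $G_2$ is a topological group, is $\mathcal{T}$-continuous if $\varphi(\mathcal{F})\longrightarrow e$ in $G_2$ for every $\mathcal{F}\in\mathcal{T}(G_1)$ with $\mathcal{F}\longrightarrow e$ in $G_1$. A topological group $G$ in $\mathsf{Ab(Top)}$ is a $\mathcal{T}k$-group if every $\mathcal{T}$-continuous homomorphism of $G$ into a compact Hausdorff group is continuous. For a discrete abelian group $A$ with dual $K=\hat A$ (so $\hat K=A$) and a subgroup $H\leq K$ (not necessarily closed), $\tau_H$ is the coarsest group topology on $A$ making every character $\chi\colon A\to\mathbb{T}$ in $H$ continuous. A topological group $G$ is precompact (not necessarily Hausdorff) if for every neighborhood $U$ of the identity there is a finite $F\subseteq G$ with $G=FU$; every precompact abelian group has the form $(A,\tau_H)$ for a uniquely determined discrete abelian group $A$ and subgroup $H\leq\hat A$. $\mathsf{Pr}_{\mathcal{T}}\mathsf{Ab}$ is the category of precompact abelian groups and their $\mathcal{T}$-continuous homomorphisms; $\mathsf{PrAb}$ is the category of precompact abelian groups and their continuous homomorphisms; $\mathcal{T}\mathsf{kPrAb}$ is the full subcategory of $\mathsf{PrAb}$ consisting of the $\mathcal{T}k$-groups. *)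

(* Defs.v *)
From HB Require Import structures.
From mathcomp Require Import all_boot all_order all_algebra.
From mathcomp Require Import all_classical all_reals.
From mathcomp Require Import topology num_normedtype tvs.

Set Implicit Arguments.
Unset Strict Implicit.
Unset Printing Implicit Defensive.

Import GRing.Theory Num.Theory numFieldTopology.Exports.
Local Open Scope classical_set_scope.
Local Open Scope ring_scope.

Definition integers (R : realType) : zmodClosed R :=
  GRing.ZmodClosed.clone R Num.int_num_subdef _.

(* The circle group R/Z.  Its choice structure is the one that comes with
   quotient_topology, which is not the one of Quotient.quot; hence the group
   structure is built by hand from the lemmas on Quotient.quot. *)
Definition circle (R : realType) : Type :=
  quotient_topology (Quotient.quot (integers R)).

HB.instance Definition _ (R : realType) :=
  Topological.copy (circle R) (quotient_topology (Quotient.quot (integers R))).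
HB.instance Definition _ (R : realType) :=
  GRing.isZmodule.Build (circle R)
    (@Quotient.addqA R (integers R)) (@Quotient.addqC R (integers R))
    (@Quotient.add0q R (integers R)) (@Quotient.addNq R (integers R)).

Section circle_topological_group.
Variable R : realType.
Local Open Scope quotient_scope.

Let p (x : R) : circle R := \pi_(Quotient.quot (integers R)) x.

Let pB x y : p (x - y) = p x - p y.
Proof. exact: (raddfB (\pi_(Quotient.quot (integers R)))). Qed.

Let p_surj (c : circle R) : exists x, c = p x.
Proof. by exists (repr (c : Quotient.quot (integers R))); rewrite /p reprK. Qed.

Let p_continuous : continuous p.
Proof. exact: (@pi_continuous _ (Quotient.quot (integers R))). Qed.

Let p_eq x y : p x = p y -> x - y \in integers R.
Proof. by move=> pxy; rewrite Quotient.idealrBE; apply/eqP. Qed.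

Let eq_p x y : x - y \in integers R -> p x = p y.
Proof. by rewrite Quotient.idealrBE => /eqP. Qed.

Let p_open (U : set R) : open U -> @open (circle R) (p @` U).
Proof.
move=> oU; change (@open R (p @^-1` (p @` U))).
have -> : p @^-1` (p @` U) =
    \bigcup_(n in [set n | n \in integers R]) ((fun x => x - n) @^-1` U).
  rewrite eqEsubset; split => [x [y Uy /p_eq yx]|x [n /= nZ Uxn]].
    exists (x - y); last by rewrite /= opprB addrC subrK.
    by rewrite /= -opprB rpredN.
  exists (x - n) => //; rewrite pB.
  suff -> : p n = 0 by rewrite subr0.
  have p0 : p 0 = 0 by rewrite -(subrr 0) pB subrr.
  by rewrite -p0; apply: eq_p; rewrite subr0.
apply: bigcup_open => n _; apply: open_comp => // x _.
apply: (@continuous_comp _ _ _ (fun z : R => (z, n)) (fun z => z.1 - z.2)).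
  apply: (@cvg_pair _ _ _ _ (nbhs x) (nbhs n)); [exact: cvg_id|exact: cvg_cst].
exact: (@sub_continuous R^o).
Qed.

Let p_nbhs (x : R) U : nbhs x U -> nbhs (p x : circle R) (p @` U).
Proof.
rewrite nbhsE => -[V [oV Vx] VU].
suff : nbhs (p x : circle R) (p @` V) by apply: filterS; exact: image_subset.
by apply: (@open_nbhs_nbhs (circle R)); split; [exact: p_open|exists x].
Qed.

Lemma circle_sub_continuous :
  continuous (fun c : circle R * circle R => c.1 - c.2).
Proof.
move=> [c d] W /=; have [x ->] := p_surj c; have [y ->] := p_surj d.
rewrite -pB => /p_continuous nW.
have cs : continuous (fun z : R * R => z.1 - z.2).
  exact: (@sub_continuous R^o).
have [[U V] /= [Ux Vy] UV] := cs (x, y) _ nW.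
exists (p @` U, p @` V) => /=; first by split; exact: p_nbhs.
by move=> [_ _] [/= [a Ua <-] [b Vb <-]]; rewrite -pB; exact: (UV (a, b)).
Qed.

End circle_topological_group.

HB.instance Definition _ (R : realType) :=
  PreTopologicalNmodule_isTopologicalZmodule.Build (circle R)
    (@circle_sub_continuous R).

(* Used when the type of f alone does not determine the intended topologies. *)
Definition continuous_map (X Y : topologicalType) (f : X -> Y) : Prop :=
  continuous f.

(* The topology of X as a set of sets; X is explicit, so that topologies on
   convertible types can be compared. *)
Definition opens (X : topologicalType) : set (set X) := open.
Arguments opens : clear implicits.

(* G_d is written discrete_topology G; its underlying type is convertible to
   that of G. *)
HB.instance Definition _ (A : zmodType) :=
  GRing.Zmodule.copy (discrete_topology A) A.

Lemma discrete_sub_continuous (A : zmodType) :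
  continuous (fun x : discrete_topology A * discrete_topology A => x.1 - x.2).
Proof.
move=> [x y] U /= Uxy; exists ([set x], [set y]) => /=.
  by split; exact: discrete_set1.
by move=> [_ _] [/= -> ->]; exact: nbhs_singleton Uxy.
Qed.

HB.instance Definition _ (A : zmodType) :=
  PreTopologicalNmodule_isTopologicalZmodule.Build (discrete_topology A)
    (@discrete_sub_continuous A).

Section pontryagin_dual.
Variables (R : realType) (G : topologicalZmodType).

Definition characters : {pred G -> circle R} :=
  mem [set chi : G -> circle R | zmod_morphism chi /\ continuous chi].

Lemma characters_zmod_closed : zmod_closed characters.
Proof.
split.
  by apply/mem_set; split=> [x y|]; [rewrite subr0|exact: cst_continuous].
move=> f g /set_mem [fB fc] /set_mem [gB gc]; apply/mem_set; split.
  by move=> x y; rewrite !fctE fB gB opprD opprK addrACA opprD opprK.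
move=> x; apply: (@continuous_comp _ _ _ (fun x => (f x, g x))
  (fun z => z.1 - z.2)); last exact: sub_continuous.
by apply: (@cvg_pair _ _ _ _ (nbhs (f x)) (nbhs (g x))); [exact: fc|exact: gc].
Qed.

HB.instance Definition _ :=
  GRing.isZmodClosed.Build (G -> circle R) characters characters_zmod_closed.

(* The Pontryagin dual: continuous characters in the compact-open topology. *)
Record dual : Type :=
  Dual { dual_fun :> G -> circle R; dual_funP : dual_fun \in characters }.

HB.instance Definition _ := [isSub for dual_fun].
HB.instance Definition _ := [Choice of dual by <:].
HB.instance Definition _ := [SubChoice_isSubZmodule of dual by <:].
HB.instance Definition _ := Topological.copy dual
  (initial_topology (dual_fun : dual -> {compact-open, G -> circle R})).

End pontryagin_dual.

Lemma topologicalZmod_regular (G : topologicalZmodType) : regular_space G.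
Proof.
move=> a O /= aO.
have [[U W] /= [Ua W0] UW] : nbhs (a, 0 : G) [set z : G * G | O (z.1 - z.2)].
  by apply: (@sub_continuous G (a, 0)); rewrite /= subr0.
exists U => // y /(_ [set z | W (z - y)]) [].
  have : (fun z : G => z - y) @ nbhs y --> y - y.
    apply: (@continuous_comp _ _ _ (fun z => (z, y))
      (fun z : G * G => z.1 - z.2) y).
      apply: (@cvg_pair _ _ _ _ (nbhs y) (nbhs y)); first exact: cvg_id.
      exact: cvg_cst.
    exact: sub_continuous.
  by apply; rewrite subrr.
move=> z [Uz Wzy]; have := UW (z, z - y) (conj Uz Wzy).
by rewrite /= opprB addrC subrK.
Qed.

Section dual_topological_group.
Variables (R : realType) (G : topologicalZmodType).
Local Notation D := (dual R G).
Local Notation CO := {compact-open, G -> circle R}.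

Lemma dual_nbhs (chi : D) (K : set G) (O : set (circle R)) :
  compact K -> open O -> (forall x, K x -> O (chi x)) ->
  \forall psi \near chi, forall x, K x -> O ((psi : D) x).
Proof.
move=> cK oO KO.
pose V := [set g : CO | g @` K `<=` O].
have oV : @open CO V by exact: compact_open_open.
exists ((fun f : D => (f : CO)) @^-1` V); split => /=.
- by exists V.
- by move=> _ [x Kx <-]; exact: KO.
- by move=> psi psiV x Kx; apply: psiV; exists x.
Qed.

Lemma dual_sub_continuous : continuous (fun z : D * D => z.1 - z.2).
Proof.
move=> [chi psi] U /= [_ [[A oA <-] /= Achi AU]].
suff : (fun z : D * D => (dual_fun (z.1 - z.2) : CO)) @ nbhs (chi, psi)
    --> (dual_fun (chi - psi) : CO).
  have nA : nbhs (dual_fun (chi - psi) : CO) A by exact: (@open_nbhs_nbhs CO).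
  move=> /(_ A nA) nAU.
  have : nbhs (chi, psi) [set z : D * D | A (z.1 - z.2)] by exact: nAU.
  by apply: (@filterS _ (nbhs (chi, psi))) => z; exact: AU.
apply/compact_open_cvgP => K O cK oO KO.
have : \forall z \near (chi, psi),
    K `<=` [set x | O ((z.1 : D) x - (z.2 : D) x)].
  have /compact_near_coveringP/near_covering_withinP cov := cK.
  apply: (cov _ (nbhs (chi, psi))
    (fun z : D * D => [set x | O (z.1 x - z.2 x)])) => x Kx.
  have [[A1 B1] /= [A1x B1x] AB] :
      nbhs (chi x, psi x) [set z : circle R * circle R | O (z.1 - z.2)].
    apply: (@sub_continuous (circle R) (chi x, psi x)).
    apply: open_nbhs_nbhs; split => //.
    by apply: KO; exists x.
  pose S (c : D) (B : set (circle R)) := exists C : set G,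
      [/\ nbhs x (C `|` ~` K), compact C & forall y, C y -> B°%classic (c y)].
  have SP (c : D) (B : set (circle R)) : nbhs (c x) B -> S c B.
    move=> Bx.
    have /topologicalZmod_regular [V Vx VB] : nbhs (c x) B°.
      exact: nbhs_interior.
    have cc : continuous c by have /set_mem[] := dual_funP c.
    exists (K `&` c @^-1` closure V); split.
    - have : nbhs x (c @^-1` V) by exact: cc.
      apply: filterS => y Vy; have [Ky|nKy] := pselect (K y); [left|by right].
      by split => //; exact: subset_closure.
    - apply: compact_closedI => //.
      apply: closed_comp => [? _|]; first exact: cc.
      exact: closed_closure.
    - by move=> y [_ /VB].
  have [C1 [nC1 cC1 C1A]] := SP chi A1 A1x.
  have [C2 [nC2 cC2 C2B]] := SP psi B1 B1x.
  exists ((C1 `|` ~` K) `&` (C2 `|` ~` K),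
    [set z : D * D | (forall y, C1 y -> A1° (z.1 y)) /\
                     (forall y, C2 y -> B1° (z.2 y))]).
    split; first exact: filterI.
    exists ([set f : D | forall y, C1 y -> A1° (f y)],
            [set f : D | forall y, C2 y -> B1° (f y)]) => //=.
    by split; apply: dual_nbhs => //; exact: open_interior.
  move=> [y [f g]] [/= [C1y C2y] [fA gB]] Ky.
  apply: (AB (f y, g y)); split => /=.
    by apply: interior_subset; apply: fA; case: C1y.
  by apply: interior_subset; apply: gB; case: C2y.
by apply: filterS => z zO _ [x Kx <-]; exact: zO.
Qed.

End dual_topological_group.

HB.instance Definition _ (R : realType) (G : topologicalZmodType) :=
  PreTopologicalNmodule_isTopologicalZmodule.Build (dual R G)
    (@dual_sub_continuous R G).


(* For a subgroup H of the dual of the discrete group A, the group A with the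
   coarsest topology making every character in H continuous; tau_coarsest and
   tau_sub_continuous show that it is also the coarsest such group topology. *)
Section tau.
Variables (R : realType) (A : zmodType).
Local Notation K := (dual R (discrete_topology A)).

Definition tau (H : set K) : Type := sup_topology
  (fun chi : {chi : K | H chi} =>
    Topological.class (initial_topology (sval chi : A -> circle R))).

Variable H : set K.

HB.instance Definition _ := Topological.copy (tau H) (sup_topology
  (fun chi : {chi : K | H chi} =>
    Topological.class (initial_topology (sval chi : A -> circle R)))).
HB.instance Definition _ := GRing.Zmodule.copy (tau H) A.

Lemma tau_character_continuous (chi : K) :
  H chi -> @continuous_map (tau H) (circle R) chi.
Proof.
move=> Hchi a; pose i : {chi : K | H chi} := exist _ chi Hchi.
apply: (@cvg_trans _ (chi @ nbhs (a : initial_topology (chi : A -> circle R)))).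
  apply: cvg_app.
  have /cvg_sup/(_ i) : nbhs (a : tau H) --> (a : tau H) by exact: cvg_id.
  exact.
exact: initial_continuous.
Qed.

Lemma tau_coarsest (S : topologicalType) (f : S -> tau H) :
  (forall chi : K, H chi -> continuous ((chi : A -> circle R) \o f)) ->
  @continuous_map S (tau H) f.
Proof.
move=> fc s; apply/cvg_sup => -[chi Hchi] U /= [_ [[V oV <-] /= Vfs VU]].
apply: (@filterS _ (nbhs s) _ (f @^-1` ((chi : A -> circle R) @^-1` V))).
  by move=> x; exact: VU.
by apply: (fc chi Hchi s); exact: open_nbhs_nbhs.
Qed.

Lemma tau_sub_continuous :
  continuous (fun x : tau H * tau H => x.1 - x.2).
Proof.
apply: tau_coarsest => chi Hchi.
have chiB : zmod_morphism chi by have /set_mem[] := dual_funP chi.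
have -> : (chi : A -> circle R) \o (fun x : tau H * tau H => x.1 - x.2) =
    (fun x => chi x.1 - chi x.2).
  by apply/funext => x /=; rewrite -chiB.
move=> x; apply: (@continuous_comp _ _ _
  (fun x : tau H * tau H => (chi x.1, chi x.2))
  (fun z : circle R * circle R => z.1 - z.2) x); last exact: sub_continuous.
apply: (@cvg_pair _ _ _ _ (nbhs (chi x.1)) (nbhs (chi x.2))).
  by apply: continuous_comp; [exact: cvg_fst|exact: tau_character_continuous].
by apply: continuous_comp; [exact: cvg_snd|exact: tau_character_continuous].
Qed.

HB.instance Definition _ :=
  PreTopologicalNmodule_isTopologicalZmodule.Build (tau H) tau_sub_continuous.

End tau.

HB.mixin Record isTopologicalGroup G & Topological G & Group G := {
  mulg_continuous : continuous (fun x : G * G => (x.1 * x.2)%g);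
  invg_continuous : continuous (fun x : G => x^-1%g);
}.

#[short(type="topologicalGroupType")]
HB.structure Definition TopologicalGroup :=
  {G of isTopologicalGroup G & Topological G & Group G}.

Definition filter_base (T : Type) (F : set_system T) : Prop :=
  [/\ F !=set0, ~ F set0 &
      forall A B, F A -> F B -> exists2 C, F C & C `<=` A `&` B].

Definition base_image (T U : Type) (f : T -> U) (F : set_system T) :
  set_system U := [set f @` A | A in F].

(* Every neighbourhood of x contains a member of F. *)
Definition base_cvg (T : topologicalType) (F : set_system T) (x : T) : Prop :=
  filter_from F id --> x.

Record continuity_type : Type := ContinuityType {
  ct :> forall G : topologicalZmodType, set (set_system G);
  ct_filter_base : forall (G : topologicalZmodType) (F : set_system G),
    @ct G F -> filter_base F;
  ct_image : forall (G1 G2 : topologicalZmodType) (phi : G1 -> G2)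
      (F : set_system G1),
    zmod_morphism phi -> continuous phi -> @ct G1 F -> @ct G2 (base_image phi F)
}.

Definition regular_ct (T : continuity_type) : Prop :=
  forall G : topologicalZmodType,
    T G = T (discrete_topology G) :> set (set_system G).

(* z_F(G), where g in G is regarded as the character x |-> x(g) of the dual. *)
Definition zset (R : realType) (G : topologicalZmodType)
    (F : set_system (dual R G)) : set G :=
  [set g | base_cvg (base_image (fun x : dual R G => x g) F) (0 : circle R)].

(* The intersection is all of G when no F qualifies. *)
Definition ct_closure (R : realType) (T : continuity_type)
    (G : topologicalZmodType) (H : set G) : set G :=
  \bigcap_(F in [set F | T (dual R G) F /\ H `<=` zset F]) zset F.
Arguments ct_closure : clear implicits.

(* That phi is a homomorphism is required separately.  The neutral element e of
   the codomain is a parameter, because codomains are written additively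
   (topologicalZmodType) or multiplicatively (topologicalGroupType). *)
Definition ct_continuous (T : continuity_type) (G1 : topologicalZmodType)
    (G2 : topologicalType) (e : G2) (phi : G1 -> G2) : Prop :=
  forall F : set_system G1, T G1 F ->
    base_cvg F (0 : G1) -> base_cvg (base_image phi F) e.

(* The group C need not be abelian. *)
Definition k_group (T : continuity_type) (G : topologicalZmodType) : Prop :=
  forall (C : topologicalGroupType) (phi : G -> C),
    compact [set: C] -> hausdorff_space C ->
    {morph phi : x y / x + y >-> (x * y)%g} ->
    ct_continuous T (1%g : C) phi -> continuous phi.

(* Not to be confused with the library's precompact, which means that the
   closure is compact. *)
Definition precompact_group (G : topologicalZmodType) : Prop :=
  forall U : set G, nbhs (0 : G) U ->
    exists2 F : set G, finite_set F & [set: G] = [set a + u | a in F & u in U].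

Record category : Type := Category {
  obj :> Type;
  hom : obj -> obj -> Type;
  idm : forall x, hom x x;
  cmp : forall x y z, hom y z -> hom x y -> hom x z;
  cmp1m : forall x y (f : hom x y), cmp (idm y) f = f;
  cmpm1 : forall x y (f : hom x y), cmp f (idm x) = f;
  cmpA : forall x y z t (h : hom z t) (g : hom y z) (f : hom x y),
    cmp h (cmp g f) = cmp (cmp h g) f
}.
Arguments hom {c} x y.
Arguments idm {c} x.
Arguments cmp {c x y z} g f.

Record functor (C D : category) : Type := Functor {
  fob :> C -> D;
  fmap : forall x y : C, hom x y -> hom (fob x) (fob y);
  fmap1 : forall x : C, fmap (idm x) = idm (fob x);
  fmapM : forall (x y z : C) (g : hom y z) (f : hom x y),
    fmap (cmp g f) = cmp (fmap g) (fmap f)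
}.
Arguments fmap {C D} F {x y} f : rename.

Definition functor_id (C : category) : functor C C :=
  @Functor C C id (fun x y f => f) (fun x => erefl) (fun x y z g f => erefl).

Program Definition functor_comp (C D E : category) (G : functor D E)
    (F : functor C D) : functor C E :=
  @Functor C E (fun x => G (F x)) (fun x y f => fmap G (fmap F f)) _ _.
Next Obligation. by move=> C D E G F x /=; rewrite !fmap1. Qed.
Next Obligation. by move=> C D E G F x y z g f /=; rewrite !fmapM. Qed.

Definition isomorphism (C : category) (x y : C) (f : hom x y) : Prop :=
  exists g : hom y x, cmp g f = idm x /\ cmp f g = idm y.

Definition naturally_isomorphic (C D : category) (F G : functor C D) : Prop :=
  exists eta : forall x : C, hom (F x) (G x),
    (forall (x y : C) (f : hom x y),
        cmp (eta y) (fmap F f) = cmp (fmap G f) (eta x)) /\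
    (forall x : C, isomorphism (eta x)).

Definition equivalence_of_categories (C D : category) (F : functor C D) : Prop :=
  exists G : functor D C,
    naturally_isomorphic (functor_comp G F) (functor_id C) /\
    naturally_isomorphic (functor_comp F G) (functor_id D).

Definition right_adjoint_to (C D : category) (U : functor D C)
    (F : functor C D) : Prop :=
  exists Phi : forall (x : C) (y : D), hom (F x) y -> hom x (U y),
    (forall x y, bijective (Phi x y)) /\
    (forall (x x' : C) (y y' : D) (h : hom x' x) (k : hom y y')
        (f : hom (F x) y),
      Phi x' y' (cmp k (cmp f (fmap F h))) =
      cmp (fmap U k) (cmp (Phi x y f) h)).

Definition full_subcategory (C : category) (P : C -> Prop) : category :=
  @Category {x : C | P x} (fun x y => hom (sval x) (sval y))
    (fun x => idm (sval x)) (fun x y z g f => cmp g f)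
    (fun x y f => cmp1m f) (fun x y f => cmpm1 f)
    (fun x y z t h g f => cmpA h g f).

Definition full_inclusion (C : category) (P : C -> Prop) :
    functor (full_subcategory P) C :=
  @Functor (full_subcategory P) C (fun x => sval x) (fun x y f => f)
    (fun x => erefl) (fun x y z g f => erefl).

Record precompact_ab : Type := PrecompactAb {
  pr_group :> topologicalZmodType;
  pr_precompact : precompact_group pr_group
}.

Lemma sig_prop_inj (T : Type) (P : T -> Prop) (u v : {x | P x}) :
  sval u = sval v -> u = v.
Proof. exact: eq_sig_hprop (fun x => @Prop_irrelevance (P x)) u v. Qed.

Lemma zmod_morphism_comp (A B C : zmodType) (g : B -> C) (f : A -> B) :
  zmod_morphism g -> zmod_morphism f -> zmod_morphism (g \o f).
Proof. by move=> gB fB x y /=; rewrite fB gB. Qed.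

Definition PrAb_hom (X Y : precompact_ab) : Type :=
  {phi : X -> Y | zmod_morphism phi /\ continuous phi}.

Definition PrAb_id (X : precompact_ab) : PrAb_hom X X.
Proof. by exists id; split => // x; exact: cvg_id. Defined.

Definition PrAb_comp (X Y Z : precompact_ab) (g : PrAb_hom Y Z)
  (f : PrAb_hom X Y) : PrAb_hom X Z.
Proof.
exists (sval g \o sval f); case: g f => [g [gB gc]] [f [fB fc]] /=.
split; first exact: zmod_morphism_comp.
by move=> x; apply: continuous_comp; [exact: fc|exact: gc].
Defined.

Program Definition PrAb : category :=
  @Category precompact_ab PrAb_hom PrAb_id PrAb_comp _ _ _.
Next Obligation. by move=> X Y f; exact: sig_prop_inj. Qed.
Next Obligation. by move=> X Y f; exact: sig_prop_inj. Qed.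
Next Obligation. by move=> X Y Z W h g f; exact: sig_prop_inj. Qed.

Lemma base_image_comp (T U V : Type) (g : U -> V) (f : T -> U)
    (F : set_system T) :
  base_image (g \o f) F = base_image g (base_image f F).
Proof.
rewrite /base_image image_comp; congr (_ @` F).
by apply/funext => A /=; rewrite image_comp.
Qed.

Lemma base_image_id (T : Type) (F : set_system T) : base_image id F = F.
Proof.
rewrite /base_image -[RHS]image_id; congr (_ @` F).
by apply/funext => A; rewrite image_id.
Qed.

(* G = (A, tau_H), where A is G without its topology. *)
Definition presented_by (R : realType) (G : topologicalZmodType)
    (H : set (dual R (discrete_topology G))) : Prop :=
  zmod_closed (mem H) /\ opens G = opens (tau H) :> set (set G).

(* The subgroup H with G = (A, tau_H) used to define the functor on objects. *)
Definition continuous_characters (R : realType) (G : topologicalZmodType) :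
    set (dual R (discrete_topology G)) :=
  [set chi : dual R (discrete_topology G) | @continuous_map G (circle R) chi].
Arguments presented_by : clear implicits.
Arguments continuous_characters : clear implicits.

Section PrT.
Variables (T : continuity_type) (hT : regular_ct T).

Definition PrT_hom (X Y : precompact_ab) : Type :=
  {phi : X -> Y | zmod_morphism phi /\ ct_continuous T (0 : Y) phi}.

Definition PrT_id (X : precompact_ab) : PrT_hom X X.
Proof. by exists id; split => // F; rewrite base_image_id. Defined.

Lemma regular_image (G1 G2 : topologicalZmodType) (phi : G1 -> G2)
    (F : set_system G1) :
  zmod_morphism phi -> T G1 F -> T G2 (base_image phi F).
Proof.
rewrite (hT G1) => phiB; apply: (@ct_image T (discrete_topology G1)) => //.
by move=> x U /nbhs_singleton Ux; apply: filterS (discrete_set1 _) => _ ->.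
Qed.

Definition PrT_comp (X Y Z : precompact_ab) (g : PrT_hom Y Z)
  (f : PrT_hom X Y) : PrT_hom X Z.
Proof.
exists (sval g \o sval f); case: g f => [g [gB gc]] [f [fB fc]] /=.
split=> [|F TF F0]; first exact: zmod_morphism_comp.
by rewrite base_image_comp; apply: gc (fc F TF F0); exact: regular_image.
Defined.

Program Definition PrT : category :=
  @Category precompact_ab PrT_hom PrT_id PrT_comp _ _ _.
Next Obligation. by move=> X Y f; exact: sig_prop_inj. Qed.
Next Obligation. by move=> X Y f; exact: sig_prop_inj. Qed.
Next Obligation. by move=> X Y Z W h g f; exact: sig_prop_inj. Qed.

Lemma continuous_ct_continuous (G1 G2 : topologicalZmodType) (phi : G1 -> G2) :
  zmod_morphism phi -> continuous phi -> ct_continuous T (0 : G2) phi.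
Proof.
move=> phiB phic F _ F0 U; rewrite -(subrr (phi 0)) -phiB subr0 => /phic/F0.
move=> [A FA AU]; exists (phi @` A); first by exists A.
by move=> _ [x Ax <-]; exact: AU.
Qed.

Definition PrAb_PrT_map (X Y : precompact_ab) (f : PrAb_hom X Y) : PrT_hom X Y.
Proof.
exists (sval f); case: f => [f [fB fc]] /=.
by split => //; exact: continuous_ct_continuous.
Defined.

Program Definition PrAb_PrT : functor PrAb PrT :=
  @Functor PrAb PrT id PrAb_PrT_map _ _.
Next Obligation. by move=> X; exact: sig_prop_inj. Qed.
Next Obligation. by move=> X Y Z g f; exact: sig_prop_inj. Qed.

Definition TkPrAb : category :=
  full_subcategory (fun X : PrAb => k_group T X).

Definition TkPrAb_PrAb : functor TkPrAb PrAb :=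
  full_inclusion (fun X : PrAb => k_group T X).

Variable R : realType.

Definition f_group (G : topologicalZmodType) : topologicalZmodType :=
  tau (ct_closure R T (dual R (discrete_topology G)) (continuous_characters R G)).

Section functor.
Hypothesis f_precompact : forall X : precompact_ab, precompact_group (f_group X).
Hypothesis f_k_group : forall X : precompact_ab, k_group T (f_group X).
Hypothesis f_continuous : forall (X Y : precompact_ab) (phi : X -> Y),
  zmod_morphism phi -> ct_continuous T (0 : Y) phi ->
  @continuous_map (f_group X) (f_group Y) phi.

Definition f_obj (X : precompact_ab) : TkPrAb :=
  exist _ (PrecompactAb (@f_precompact X)) (@f_k_group X).

Definition f_map (X Y : precompact_ab) (phi : PrT_hom X Y) :
  @hom TkPrAb (f_obj X) (f_obj Y).
Proof.
exists (sval phi); case: phi => [phi [phiB phic]] /=.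
by split => //; exact: f_continuous.
Defined.

Program Definition f_functor : functor PrT TkPrAb :=
  @Functor PrT TkPrAb f_obj f_map _ _.
Next Obligation. by move=> X; exact: sig_prop_inj. Qed.
Next Obligation. by move=> X Y Z g f; exact: sig_prop_inj. Qed.

End functor.
End PrT.

(* Main.v *)
(* Two facts about characters carry the proof.
   (A) A character that is small on a Bohr set of finitely many characters
   belongs to the group they generate (bohr_character); it gives both the
   uniqueness of H in (A, tau_H) and the duality between a discrete group and
   its compact dual.
   (B) In a precompact group every neighbourhood of 0 contains a Bohr set of
   finitely many continuous characters (character_nbhs).
   Both rest on an invariant mean.  For (B), the correlation of a bump function
   with itself is a positive definite function, and a convexity argument
   (minimizing an affine functional with a small strictly concave term over the
   compact convex set of normalized positive definite functions) replaces it by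
   solutions of d'Alembert's equation, that is, by cosines of characters.
   By duality and regularity, the closure of H consists of the characters that
   are T-continuous on (A, tau_H).  Hence T-continuous homomorphisms become
   continuous for the closed topologies, a homomorphism into a compact group
   induces by (B) a topology given by characters, which makes (A, tau_f(H)) a
   k-group, and on a k-group the identity to the closed topology is continuous
   because the circle is compact. *)
Require Import Defs.
From HB Require Import structures.
From mathcomp Require Import all_boot all_order all_algebra.
From mathcomp Require Import all_classical all_reals.
From mathcomp Require Import topology num_normedtype tvs.
From mathcomp Require Import normedtype sequences trigo.
From mathcomp Require Import ring lra.

Set Implicit Arguments.
Unset Strict Implicit.
Unset Printing Implicit Defensive.

Import Order.TTheory GRing.Theory Num.Theory.
Import numFieldTopology.Exports numFieldNormedType.Exports.
Local Open Scope classical_set_scope.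
Local Open Scope ring_scope.

(** * The circle *)

Section circle_trigonometry.
Variable R : realType.
Local Open Scope quotient_scope.
Implicit Types c d : circle R.

Definition to_circle (x : R) : circle R := \pi_(Quotient.quot (integers R)) x.

(** Real and imaginary parts of exp (2 pi i c); [trig_mod_int] gives the independence of the
    representative. *)
Definition ccos c : R := cos (pi *+ 2 * repr (c : Quotient.quot (integers R))).
Definition csin c : R := sin (pi *+ 2 * repr (c : Quotient.quot (integers R))).

Lemma to_circleD x y : to_circle (x + y) = to_circle x + to_circle y.
Proof. exact: (raddfD (\pi_(Quotient.quot (integers R)))). Qed.

Lemma to_circleN x : to_circle (- x) = - to_circle x.
Proof. exact: (raddfN (\pi_(Quotient.quot (integers R)))). Qed.

Lemma to_circle0 : to_circle 0 = 0.
Proof. exact: (raddf0 (\pi_(Quotient.quot (integers R)))). Qed.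

Lemma to_circle_repr c :
  to_circle (repr (c : Quotient.quot (integers R))) = c.
Proof. exact: (@reprK _ (Quotient.quot (integers R))). Qed.

Lemma to_circle_eq x y : to_circle x = to_circle y <-> x - y \is a Num.int.
Proof.
split; first by move=> pxy; rewrite -[_ \is a _]/(_ \in integers R)
  Quotient.idealrBE; apply/eqP.
by rewrite -[_ \is a _]/(_ \in integers R) Quotient.idealrBE => /eqP.
Qed.

Lemma to_circle_continuous : continuous to_circle.
Proof. exact: (@pi_continuous _ (Quotient.quot (integers R))). Qed.

Lemma to_circle_surj c : exists2 x, 0 <= x < 1 & c = to_circle x.
Proof.
pose x := repr (c : Quotient.quot (integers R)).
have /andP[x1 x2] := real_floor_itv (num_real x).
exists (x - (Num.floor x)%:~R).
  by rewrite subr_ge0 x1 ltrBlDl -intrD1.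
rewrite -[LHS]to_circle_repr; apply/to_circle_eq.
by rewrite opprB addrCA subrr addr0 intr_int.
Qed.

Lemma trig_int (n : R) : n \is a Num.int ->
  cos (pi *+ 2 * n) = 1 :> R /\ sin (pi *+ 2 * n) = 0 :> R.
Proof.
move=> /intrP[m ->].
have nat_case k : cos (pi *+ 2 * k%:R) = 1 :> R /\ sin (pi *+ 2 * k%:R) = 0 :>
  R.
  elim: k => [|k [ck sk]]; first by rewrite mulr0 cos0 sin0.
  by rewrite -natr1 mulrDr mulr1 cosD2pi sinD2pi.
case: m => k; first by rewrite -pmulrn; exact: nat_case.
rewrite NegzE mulrNz mulrN cosN sinN -pmulrn.
by have [-> ->] := nat_case k.+1; rewrite oppr0.
Qed.

Lemma trig_mod_int (x y : R) : x - y \is a Num.int ->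
  cos (pi *+ 2 * x) = cos (pi *+ 2 * y) /\
  sin (pi *+ 2 * x) = sin (pi *+ 2 * y).
Proof.
move=> /trig_int[c1 s0]; rewrite -[x in cos (_ * x)](subrK y).
rewrite -[x in sin (_ * x)](subrK y) mulrDr cosD sinD c1 s0.
by rewrite !mul0r !mul1r subr0 add0r.
Qed.

Lemma ccosE x : ccos (to_circle x) = cos (pi *+ 2 * x).
Proof. by apply: (trig_mod_int _).1; apply/to_circle_eq/to_circle_repr. Qed.

Lemma csinE x : csin (to_circle x) = sin (pi *+ 2 * x).
Proof. by apply: (trig_mod_int _).2; apply/to_circle_eq/to_circle_repr. Qed.

Lemma ccos0 : ccos 0 = 1.
Proof. by rewrite -to_circle0 ccosE mulr0 cos0. Qed.

Lemma ccosD c d : ccos (c + d) = ccos c * ccos d - csin c * csin d.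
Proof.
have [x _ ->] := to_circle_surj c; have [y _ ->] := to_circle_surj d.
by rewrite -to_circleD !ccosE !csinE mulrDr cosD.
Qed.

Lemma csinD c d : csin (c + d) = csin c * ccos d + ccos c * csin d.
Proof.
have [x _ ->] := to_circle_surj c; have [y _ ->] := to_circle_surj d.
by rewrite -to_circleD !ccosE !csinE mulrDr sinD.
Qed.

Lemma ccosN c : ccos (- c) = ccos c.
Proof.
have [x _ ->] := to_circle_surj c.
by rewrite -to_circleN !ccosE mulrN cosN.
Qed.

Lemma csinN c : csin (- c) = - csin c.
Proof.
have [x _ ->] := to_circle_surj c.
by rewrite -to_circleN !csinE mulrN sinN.
Qed.

Lemma ccosB c d : ccos (c - d) = ccos c * ccos d + csin c * csin d.
Proof. by rewrite ccosD ccosN csinN; ring. Qed.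

Lemma ccos2Dcsin2 c : ccos c ^+ 2 + csin c ^+ 2 = 1.
Proof. exact: cos2Dsin2. Qed.

Lemma ccos_le1 c : ccos c <= 1. Proof. exact: cos_le1. Qed.
Lemma ccos_geN1 c : -1 <= ccos c. Proof. exact: cos_geN1. Qed.

Lemma ccosDB c d : ccos (c + d) + ccos (c - d) = 2 * ccos c * ccos d.
Proof. by rewrite ccosD ccosB; ring. Qed.

Lemma ltr_cos2pi (x y : R) : 0 <= x <= 2^-1 -> 0 <= y <= 2^-1 ->
  (cos (pi *+ 2 * x) < cos (pi *+ 2 * y)) = (y < x).
Proof.
have pi0 := @pi_gt0 R.
have piI (z : R) : 0 <= z <= 2^-1 -> pi *+ 2 * z \in `[0, pi].
  move=> /andP[z0 z1]; rewrite in_itv /=; apply/andP; split.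
    by rewrite mulr_ge0// mulrn_wge0// ltW.
  rewrite mulrnAl -mulrnAr -[leRHS]mulr1 ler_pM2l//.
  by rewrite -mulr_natl; lra.
move=> /piI xI /piI yI; rewrite ltr_cos// ltr_pM2l//.
by rewrite pmulrn_rgt0.
Qed.

(** The quantity [1 - ccos c] measures the distance to 0: every class has a representative of
    absolute value at most 1/2, where the cosine determines the absolute value. *)
Lemma ccos_near0 (U : set (circle R)) : nbhs (0 : circle R) U ->
  exists2 e : R, 0 < e & forall c, 1 - ccos c < e -> U c.
Proof.
rewrite -to_circle0 => /to_circle_continuous/nbhs_ballP[d0 /= d0_gt0 dU].
pose d := Num.min d0 2^-1.
have d_gt0 : 0 < d by rewrite lt_min d0_gt0 /= invr_gt0 ltr0n.
have d_le : d <= 2^-1 by rewrite ge_min lexx orbT.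
have cos_0 : cos (pi *+ 2 * 0) = 1 :> R by rewrite mulr0 cos0.
exists (1 - cos (pi *+ 2 * d)) => [|c].
  by rewrite subr_gt0 -cos_0 ltr_cos2pi// ?lexx ?(ltW d_gt0)//= invr_ge0.
have [x0 /andP[x0_ge0 x0_lt1] ->] := to_circle_surj c.
have [x [-> xle]] : exists x, to_circle x0 = to_circle x /\ `|x| <= 2^-1.
  have [xs|xb] := leP x0 2^-1.
    by exists x0; split => //; rewrite ger0_norm.
  exists (x0 - 1); split; last by rewrite ler0_norm; lra.
  by apply/to_circle_eq; rewrite opprB addrCA subrr addr0.
rewrite ccosE ltrD2l ltrN2 => cosx; apply: dU; rewrite /ball /= sub0r normrN.
suff : `|x| < d by rewrite lt_min => /andP[].
have pi2 : 0 <= pi *+ 2 :> R by rewrite mulrn_wge0 ?pi_ge0.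
move: cosx; rewrite -[cos (_ * x)]cos_norm normrM (ger0_norm pi2).
by rewrite ltr_cos2pi ?normr_ge0 ?(ltW d_gt0).
Qed.

Lemma ccos_eq1 c : ccos c = 1 -> c = 0.
Proof.
have [x /andP[x0 x1] ->] := to_circle_surj c; rewrite ccosE => cx.
have pi0 := @pi_gt0 R.
have cos_0 : cos (pi *+ 2 * 0) = 1 :> R by rewrite mulr0 cos0.
have half0 : 0 <= (2 : R)^-1 by rewrite invr_ge0.
suff -> : x = 0 by exact: to_circle0.
have [xs|xb] := leP x 2^-1.
  apply/eqP; rewrite eq_le x0 andbT leNgt; apply/negP.
  by rewrite -ltr_cos2pi ?cx ?cos_0 ?ltxx ?lexx ?x0.
have : 0 < 1 - x by rewrite subr_gt0.
rewrite -ltr_cos2pi ?lexx ?half0//; last by apply/andP; split; lra.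
by rewrite mulrBr mulr1 -cosN opprB cosB cos2pi sin2pi mulr1 mulr0 addr0
  cos_0 cx ltxx.
Qed.

Lemma circle_inj c d : ccos c = ccos d -> csin c = csin d -> c = d.
Proof.
move=> cc ss; apply/subr0_eq/ccos_eq1.
by rewrite ccosB cc ss -!expr2 ccos2Dcsin2.
Qed.

Lemma circle_point (a b : R) : a ^+ 2 + b ^+ 2 = 1 ->
  exists c, ccos c = a /\ csin c = b.
Proof.
move=> ab; have a1 : -1 <= a <= 1 by apply/andP; split; nra.
have pi0 : pi *+ 2 != 0 :> R by rewrite mulrn_eq0 /= gt_eqF ?pi_gt0.
have acosx s : pi *+ 2 * (s * acos a / (pi *+ 2)) = s * acos a.
  by rewrite mulrC divfK.
have sin2 : Num.sqrt (1 - a ^+ 2) = `|b|.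
  by rewrite -ab addrC addKr sqrtr_sqr.
have [b0|b0] := leP 0 b.
  exists (to_circle (1 * acos a / (pi *+ 2))).
  by rewrite ccosE csinE acosx mul1r acosK ?in_itv// sin_acos// sin2 ger0_norm.
exists (to_circle (-1 * acos a / (pi *+ 2))).
rewrite ccosE csinE acosx mulN1r cosN sinN acosK ?in_itv// sin_acos// sin2.
by rewrite ltr0_norm// opprK.
Qed.

Lemma circle_function_continuous (f : circle R -> R) (g : R -> R) :
  (forall x, f (to_circle x) = g (pi *+ 2 * x)) -> continuous g -> continuous f.
Proof.
move=> fg gc; apply: (@quotient_continuous _ (Quotient.quot (integers R)) _
  f).2.
have -> : f \o (\pi_(Quotient.quot (integers R)))%qT = fun x => g (pi *+ 2 * x).
  by apply/funext => y; exact: fg.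
move=> x; apply: (@continuous_comp _ _ _ (fun y : R => pi *+ 2 * y) g x).
  exact: mulrl_continuous.
exact: gc.
Qed.

Lemma ccos_continuous : continuous ccos.
Proof. exact: circle_function_continuous ccosE (@continuous_cos R). Qed.

Lemma csin_continuous : continuous csin.
Proof. exact: circle_function_continuous csinE (@continuous_sin R). Qed.

Lemma circle_compact : compact [set: circle R].
Proof.
have -> : [set: circle R] = to_circle @` `[0, 1].
  rewrite eqEsubset; split => // c _; have [x /andP[x0 x1] ->] :=
    to_circle_surj c.
  by exists x => //; rewrite /= in_itv /= x0 ltW.
apply: continuous_compact (@segment_compact R 0 1).
exact: continuous_subspaceT to_circle_continuous.
Qed.

Lemma circle_hausdorff : hausdorff_space (circle R).
Proof.
move=> c d cd; have eq_of (f : circle R -> R) : continuous f -> f c = f d.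
  move=> fc; apply: (@norm_hausdorff _ R) => U V /fc cU /fc dV.
  by have [z [Uz Vz]] := cd _ _ cU dV; exists (f z).
by apply: circle_inj; apply: eq_of; [exact: ccos_continuous|exact:
  csin_continuous].
Qed.

End circle_trigonometry.

(** * Invariant means on abelian groups *)

Section means.
Variables (R : realType) (G : zmodType).
Implicit Types (s E : seq G) (g h : G -> R) (c C : R).

Definition avg s g : R := (size s)%:R^-1 * \sum_(t <- s) g t.

Lemma avgD s g h : avg s (fun t => g t + h t) = avg s g + avg s h.
Proof. by rewrite /avg big_split mulrDr. Qed.

Lemma avgZ s c g : avg s (fun t => c * g t) = c * avg s g.
Proof. by rewrite /avg -mulr_sumr mulrCA. Qed.

Lemma avgB s g h : avg s (fun t => g t - h t) = avg s g - avg s h.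
Proof. by rewrite /avg big_split sumrN mulrDr mulrN. Qed.

Lemma avg_cst s c : s != [::] -> avg s (fun=> c) = c.
Proof.
move=> s0; rewrite /avg big_const_seq count_predT iter_addr_0 -[c *+
  _]mulr_natl.
by rewrite mulKf// pnatr_eq0 size_eq0.
Qed.

Lemma ler_avg s g h : (forall t, g t <= h t) -> avg s g <= avg s h.
Proof.
by move=> gh; rewrite /avg ler_wpM2l ?invr_ge0//; apply: ler_sum.
Qed.

Lemma ler_norm_avg s g C : s != [::] -> (forall t, `|g t| <= C) ->
  `|avg s g| <= C.
Proof.
move=> s0 gC; rewrite ler_norml; apply/andP; split.
  by rewrite -(avg_cst (- C) s0) ler_avg// => t; case/ler_normlP: (gC t); lra.
by rewrite -[leRHS](avg_cst C s0) ler_avg// => t; case/ler_normlP: (gC t).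
Qed.

(** Induction on [E]: adding the multiples 0, y, ..., n y to the elements of [s] gives near
    invariance under y by telescoping. That under earlier elements persists, since averaging along y
    commutes with translations and preserves bounds. *)
Lemma folner E n : exists2 s, s != [::] &
  forall y, y \in E -> forall g C, (forall t, `|g t| <= C) ->
    `|avg s (fun t => g (t + y)) - avg s g| <= 2 * C / n.+1%:R.
Proof.
elim: E => [|y E [s s0 sE]]; first by exists [:: 0].
pose s' := [seq t + y *+ k | t <- s, k <- iota 0 n.+1].
pose w g t := n.+1%:R^-1 * \sum_(k <- iota 0 n.+1) g (t + y *+ k).
have avg_s' g : avg s' g = avg s (w g).
  rewrite /avg /s' big_allpairs_dep size_allpairs size_iota natrM.
  by rewrite invfM -mulrA -mulr_sumr.
have wB g h t : w g t - w h t = w (fun t => g t - h t) t.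
  by rewrite /w big_split sumrN mulrDr mulrN.
exists s'; first by rewrite -size_eq0 size_allpairs size_iota muln_eq0 size_eq0
  negb_or s0.
move=> z; rewrite inE => /predU1P[->|zE] g C gC.
  rewrite !avg_s' -avgB; apply: ler_norm_avg => // t.
  rewrite wB /w.
  under eq_bigr => k _ do rewrite -addrA -mulrSr.
  have -> : iota 0 n.+1 = index_iota 0 n.+1 by rewrite /index_iota subn0.
  rewrite telescope_sumr// mulr0n addr0 normrM ger0_norm ?invr_ge0//.
  rewrite mulrC ler_wpM2r ?invr_ge0//.
  by rewrite (le_trans (ler_normB _ _))// mulr_natl mulr2n lerD.
rewrite !avg_s'.
have -> : w (fun t => g (t + z)) = fun t => w g (t + z).
  by apply/funext => t; rewrite /w; under eq_bigr => k _ do rewrite addrAC.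
apply: sE => // t; rewrite /w normrM ger0_norm ?invr_ge0// mulrC.
rewrite ler_pdivrMr// (le_trans (ler_norm_sum _ _ _))//.
rewrite (le_trans (ler_sum _ (fun k _ => gC _)))//.
by rewrite big_const_seq count_predT iter_addr_0 size_iota mulr_natr.
Qed.

Definition bdd g := exists C, forall t, `|g t| <= C.

Lemma bdd_cst c : bdd (fun=> c).
Proof. by exists `|c|. Qed.

Lemma bddD g h : bdd g -> bdd h ->
  bdd (fun t => g t + h t).
Proof.
move=> [C gC] [D hD]; exists (C + D) => t.
by rewrite (le_trans (ler_normD _ _))// lerD.
Qed.

Lemma bddM g h : bdd g -> bdd h ->
  bdd (fun t => g t * h t).
Proof.
move=> [C gC] [D hD]; exists (C * D) => t.
by rewrite normrM ler_pM.
Qed.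

Lemma bddB g h : bdd g -> bdd h -> bdd (fun t => g t - h t).
Proof.
move=> [C gC] [D hD]; exists (C + D) => t.
by rewrite (le_trans (ler_normB _ _))// lerD.
Qed.

Lemma bdd_shift g y : bdd g -> bdd (fun t => g (t + y)).
Proof. by move=> [C gC]; exists C. Qed.

Lemma bdd_sum (I : Type) (r : seq I) (f : I -> G -> R) :
  (forall i, bdd (f i)) -> bdd (fun t => \sum_(i <- r) f i t).
Proof.
move=> fb; elim: r => [|i r IHr].
  by exists 0 => t; rewrite big_nil normr0.
have [C fC] := bddD (fb i) IHr.
by exists C => t; rewrite big_cons.
Qed.

Lemma bdd01 g : (forall t, 0 <= g t <= 1) -> bdd g.
Proof. by move=> g01; exists 1 => t; case/andP: (g01 t) => ? ?;
  rewrite ger0_norm. Qed.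

Record mean : Type := Mean {
  mean_fun :> (G -> R) -> R;
  meanD : forall g h, bdd g -> bdd h ->
    mean_fun (fun t => g t + h t) = mean_fun g + mean_fun h;
  meanZ : forall c g, bdd g ->
    mean_fun (fun t => c * g t) = c * mean_fun g;
  mean_ge0 : forall g, bdd g -> (forall t, 0 <= g t) -> 0 <= mean_fun g;
  mean1 : mean_fun (fun=> 1) = 1;
  mean_shift : forall g y, bdd g ->
    mean_fun (fun t => g (t + y)) = mean_fun g
}.

End means.

Section cofinal_sequences.
Variable T : choiceType.

(* Inclusion with multiplicities: a set of this filter that contains all E
   above nseq n x only contains sequences of size at least n. *)
Definition cofinal_seqs : set_system (seq T) :=
  [set S | exists E0, forall E : seq T,
    (forall x, (count_mem x E0 <= count_mem x E)%N) -> S E].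

#[global] Instance cofinal_seqs_filter : ProperFilter cofinal_seqs.
Proof.
split; first by move=> [E0 /(_ E0)]; exact.
split.
- by exists [::].
- move=> S S' [E0 ES] [E1 ES']; exists (E0 ++ E1) => E cE; split.
    by apply: ES => x; rewrite (leq_trans _ (cE x))// count_cat leq_addr.
  by apply: ES' => x; rewrite (leq_trans _ (cE x))// count_cat leq_addl.
- by move=> S S' SS' [E0 ES]; exists E0 => E /ES/SS'.
Qed.

Lemma cofinal_seqs_sub (E0 : seq T) :
  \forall E \near cofinal_seqs, {subset E0 <= E}.
Proof.
exists E0 => E cE x; rewrite -!has_pred1 !has_count => xE0.
exact: leq_trans (cE x).
Qed.

Lemma cofinal_seqs_size (n : nat) (x : T) :
  \forall E \near cofinal_seqs, (n <= size E)%N.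
Proof.
exists (nseq n x) => E /(_ x); rewrite count_nseq /= eqxx mul1n => /leq_trans.
by apply; exact: count_size.
Qed.

End cofinal_sequences.

(** A cluster point of an ultrafilter is a limit, and the interval is compact. *)
Lemma ultra_bounded_cvg (R : realType) (I : Type) (U : set_system I)
    (UU : UltraFilter U) (u : I -> R) (C : R) :
  (forall i, `|u i| <= C) -> exists l : R, u @ U --> l.
Proof.
move=> uC; have : compact `[- C, C] by exact: segment_compact.
move=> /(_ (u @ U)) [|l [_ ul]].
  by apply: (@filterE _ U) => i; rewrite /= in_itv /= -ler_norml.
exists l => V lV; have [//|UVC] := in_ultra_setVsetC (u @^-1` V) UU.
by have [x [/= nVx Vx]] := ul (~` V) V UVC lV.
Qed.

(** The mean is an ultralimit of Folner averages. Along the ultrafilter, [E] eventually contains any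
    given element and exceeds any given size, so the error [2 * C / (size E).+1] tends to 0. *)
Lemma mean_exists (R : realType) (G : zmodType) : inhabited (mean R G).
Proof.
have [U [UU FU]] := ultraFilterLemma (@cofinal_seqs_filter G).
have /choice[s_ s_P] : forall E : seq G, exists s : seq G, s != [::] /\
    forall y, y \in E -> forall (g : G -> R) C, (forall t, `|g t| <= C) ->
    `|avg s (fun t => g (t + y)) - avg s g| <= 2 * C / (size E).+1%:R.
  by move=> E; have [s] := folner R E (size E); exists s.
pose m (g : G -> R) : R := lim (avg (s_ E) g @[E --> U]).
have mP g : bdd g -> avg (s_ E) g @[E --> U] --> m g.
  move=> [C gC]; apply/cvg_ex => /=; apply: (@ultra_bounded_cvg _ _ _ _ _ C).
  by move=> E; apply: ler_norm_avg (s_P E).1 gC.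
have m_lim g (l : R) : avg (s_ E) g @[E --> U] --> l -> m g = l.
  by move=> /cvg_lim; exact.
constructor; apply: (@Mean _ _ m).
- move=> g h gb hb; apply: m_lim.
  by under eq_fun do rewrite avgD; apply: cvgD; exact: mP.
- move=> c g gb; apply: m_lim.
  by under eq_fun do rewrite avgZ; apply: cvgMr; exact: mP.
- move=> g gb g0; apply: (cvgr_to_ge (mP g gb)).
  by apply: filterE => E; rewrite -(avg_cst 0 (s_P E).1) ler_avg.
- apply: m_lim; under eq_fun => E do rewrite (avg_cst 1 (s_P E).1).
  exact: cvg_cst.
- move=> g y gb; have [C gC] := gb; apply: m_lim.
  rewrite -[m g]add0r.
  have -> : (fun E => avg (s_ E) (fun t => g (t + y))) = (fun E =>
    (avg (s_ E) (fun t => g (t + y)) - avg (s_ E) g) + avg (s_ E) g).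
    by apply/funext => E; rewrite subrK.
  apply: cvgD (mP g gb).
  apply/cvgr0Pnorm_le => e e0; apply: FU.
  pose n := Num.truncn (2 * C / e).
  apply: filterS2 (cofinal_seqs_sub [:: y]) (cofinal_seqs_size n (0 : G)).
  move=> E yE nE; rewrite (le_trans ((s_P E).2 y _ g C gC))//.
    by apply: yE; rewrite inE.
  rewrite ler_pdivrMr// -ler_pdivrMl// mulrC.
  rewrite (le_trans (ltW (truncnS_gt _)))// ler_nat.
  by [].
Qed.

(** * Bohr sets *)

Section zmod_morphism_theory.
Variables (A B : zmodType) (f : A -> B).
Hypothesis fB : zmod_morphism f.

Lemma zmod_morph0 : f 0 = 0.
Proof. by rewrite -(subrr 0) fB subrr. Qed.

Lemma zmod_morphN x : f (- x) = - f x.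
Proof. by rewrite -sub0r fB zmod_morph0 sub0r. Qed.

Lemma zmod_morphD x y : f (x + y) = f x + f y.
Proof. by rewrite -{1}[y]opprK fB zmod_morphN opprK. Qed.

End zmod_morphism_theory.

Lemma prod_itv01 (R : realType) (I : Type) (r : seq I) (f : I -> R) :
  (forall i, 0 <= f i <= 1) -> 0 <= \prod_(i <- r) f i <= 1.
Proof.
move=> f01; elim: r => [|i r IHr]; first by rewrite big_nil ler01 lexx.
rewrite big_cons; case/andP: IHr => P0 P1; case/andP: (f01 i) => f0 f1.
by rewrite mulr_ge0//= mulr_ile1.
Qed.

Lemma prod_ge1B (R : realType) (I : eqType) (r : seq I) (f : I -> R) (d : R) :
  (forall i, 0 <= f i <= 1) -> (forall i, i \in r -> 1 - d <= f i) ->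
  1 - (size r)%:R * d <= \prod_(i <- r) f i.
Proof.
move=> f01; elim: r => [|i r IHr] fd; first by rewrite big_nil mul0r subr0.
have /IHr : forall j, j \in r -> 1 - d <= f j.
  by move=> j jr; apply: fd; rewrite inE jr orbT.
have : 1 - d <= f i by apply: fd; rewrite inE eqxx.
have /andP[] := prod_itv01 r f01; have /andP[] := f01 i.
rewrite big_cons [size _]/= -natr1 mulrDl mul1r.
set P := \prod_(j <- r) f j; set sd := _ * d; nra.
Qed.

Lemma eventually_expr_lt (R : realType) (a b e : R) : 0 < a -> a < b -> 0 < e ->
  exists n : nat, a ^+ n < e * b ^+ n.
Proof.
move=> a0 ab e0; have b0 : 0 < b by exact: lt_trans ab.
have q1 : `|a / b| < 1.
  by rewrite ger0_norm ?divr_ge0 ?ltW// ltr_pdivrMr// mul1r.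
have /cvgrPdist_lt/(_ e e0) := cvg_expr q1.
move=> [n _ /(_ n (leqnn n))]; rewrite sub0r normrN normrX.
rewrite ger0_norm ?divr_ge0 ?ltW// expr_div_n ltr_pdivrMr ?exprn_gt0//.
by exists n.
Qed.

Section bohr_sets.
Variables (R : realType) (G : zmodType).
Implicit Types (chi psi : G -> circle R) (l : seq (G -> circle R)) (e : R).

(** The circle is cut into [m.+1] equal arcs, shorter than a radius [d] within which the cosine is
    close to 1. *)
Lemma circle_cells e : 0 < e -> exists (m : nat) (cell : circle R -> 'I_m),
  forall c d, cell c = cell d -> 1 - ccos (c - d) < e.
Proof.
move=> e0.
have : nbhs (0 : R) [set x | 1 - cos (pi *+ 2 * x) < e].
  have : {for 0, continuous (fun x : R => cos (pi *+ 2 * x))}.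
    apply: (@continuous_comp _ _ _ (fun y : R => pi *+ 2 * y) cos 0).
      exact: mulrl_continuous.
    exact: continuous_cos.
  move=> /cvgrPdist_lt/(_ e e0); apply: filterS => x.
  by rewrite mulr0 cos0; apply: le_lt_trans; rewrite ler_norm.
move=> /nbhs_ballP[d /= d0 dP].
have /choice[r rP] : forall c : circle R,
    exists x : R, 0 <= x < 1 /\ c = to_circle x.
  by move=> c; have [x] := to_circle_surj c; exists x.
pose m := Num.truncn d^-1.
pose cell c : 'I_m.+1 := inord (Num.truncn (m.+1%:R * r c)).
exists m.+1, cell => c d' /(congr1 val) /=.
have rM x : (0 <= r x)%R /\ (Num.truncn (m.+1%:R * r x) < m.+1)%N.
  have [/andP[r0 r1] _] := rP x; split=> //.
  by rewrite truncn_lt_nat ?mulr_ge0// -[ltRHS]mulr1 ltr_pM2l.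
have [c0 cM] := rM c; have [d'0 dM] := rM d'; rewrite !inordK// => cd.
rewrite (rP c).2 (rP d').2 -to_circleN -to_circleD ccosE;
  apply: (dP (r c - r d')).
rewrite /ball /= sub0r normrN -(ltr_pM2l (ltr0Sn R m)).
have /andP[u1 u2] := truncn_itv (mulr_ge0 (ler0n R m.+1) c0).
have /andP[v1 v2] := truncn_itv (mulr_ge0 (ler0n R m.+1) d'0).
have md : 1 < m.+1%:R * d.
  by rewrite -(ltr_pM2r (_ : 0 < d^-1)) ?invr_gt0// mulfK ?gt_eqF// mul1r
    truncnS_gt.
rewrite -[X in X * `|_|]gtr0_norm// -normrM mulrBr; apply: lt_trans md.
move: u1 u2 v1 v2; rewrite cd; set k := Num.truncn _; rewrite -[k.+1%:R]natr1.
by move=> *; rewrite ltr_norml; lra.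
Qed.

(** Pigeonhole over the cells of one character after the other. [S] is arbitrary and contains the
    centres, so that the induction applies to the part of [S] on which the next character stays in
    one cell. *)
Lemma bohr_cover l e : 0 < e -> (forall chi, chi \in l -> zmod_morphism chi) ->
  forall S : set G, exists F : seq G, forall x, S x ->
    exists a, [/\ a \in F, S a & forall chi, chi \in l ->
                1 - ccos (chi (x - a)) < e].
Proof.
move=> e0; have [m [cell cellP]] := circle_cells e0.
elim: l => [_ S|chi l IHl lB S].
  have [[a Sa]|nS] := pselect (exists a, S a).
    by exists [:: a] => x _; exists a; rewrite inE.
  by exists [::] => x Sx; case: nS; exists x.
have /IHl{}IHl : forall psi, psi \in l -> zmod_morphism psi.
  by move=> psi psil; apply: lB; rewrite inE psil orbT.
have chiB : zmod_morphism chi by apply: lB; rewrite inE eqxx.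
have /choice[F FP] := fun i : 'I_m => IHl (S `&` [set x | cell (chi x) = i]).
exists (flatten [seq F i | i <- enum 'I_m]) => x Sx.
have [a [aF [Sa xa] al]] := FP (cell (chi x)) x (conj Sx erefl).
exists a; split => //.
  apply/flattenP; exists (F (cell (chi x))) => //.
  by apply: map_f; rewrite mem_enum.
move=> psi; rewrite inE => /predU1P[->|]; last exact: al.
by rewrite chiB; apply: cellP.
Qed.

Variable m : mean R G.

Lemma mean_cst c : m (fun=> c) = c.
Proof.
have := meanZ m c (bdd_cst G (1 : R)); rewrite mean1 mulr1 => {2}<-.
by congr (m _); apply/funext => t; rewrite mulr1.
Qed.

Lemma meanB (g h : G -> R) : bdd g -> bdd h ->
  m (fun t => g t - h t) = m g - m h.
Proof.
move=> gb hb; have hb' := bddM (bdd_cst G (-1)) hb.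
rewrite -[- m h]mulN1r -(meanZ m _ hb) -(meanD m gb hb').
by congr (m _); apply/funext => t; rewrite mulN1r.
Qed.

Lemma ler_mean (g h : G -> R) : bdd g -> bdd h ->
  (forall t, g t <= h t) -> m g <= m h.
Proof.
move=> gb hb gh; rewrite -subr_ge0 -meanB//; apply: mean_ge0.
  have := bddD hb (bddM (bdd_cst G (-1)) gb).
  by congr bdd; apply/funext => t; rewrite mulN1r.
by move=> t; rewrite subr_ge0.
Qed.

Lemma mean_sum (I : Type) (r : seq I) (f : I -> G -> R) :
  (forall i, bdd (f i)) ->
  m (fun t => \sum_(i <- r) f i t) = \sum_(i <- r) m (f i).
Proof.
move=> fb; elim: r => [|i r IHr].
  by rewrite big_nil -[RHS](mean_cst 0); congr (m _); apply/funext => t;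
    rewrite big_nil.
rewrite big_cons -IHr -meanD//; last exact: bdd_sum.
by congr (m _); apply/funext => t; rewrite big_cons.
Qed.

(** The translates of [g] by the elements of [F] all have the same mean, and they add up to at least
    1 everywhere. *)
Lemma mean_cover (W : set G) (F : seq G) :
  (forall x, exists2 a, a \in F & W (x - a)) ->
  forall g, bdd g -> (forall t, 0 <= g t) ->
    (forall t, W t -> 1 <= g t) -> (size F)%:R^-1 <= m g.
Proof.
move=> FW g gb g0 gW.
have F0 : F != [::] by have [a] := FW 0; case: F FW.
rewrite -(@ler_pM2l _ (size F)%:R) ?divff ?pnatr_eq0 ?ltr0n ?size_eq0 ?lt0n
  ?size_eq0//.
have fb a : bdd (fun t => g (t - a)) by exact: bdd_shift.
have -> : (size F)%:R * m g = m (fun t => \sum_(a <- F) g (t - a)).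
  rewrite mean_sum//; under eq_bigr => a _ do rewrite mean_shift//.
  by rewrite big_const_seq count_predT iter_addr_0 mulr_natl.
rewrite -[leLHS](mean_cst 1); apply: ler_mean => [||t];
  [exact: bdd_cst|exact: bdd_sum|].
have [a aF Wta] := FW t; rewrite (big_rem a)//= -[leLHS]addr0 lerD ?gW//.
exact: sumr_ge0.
Qed.

Lemma bdd_ccos chi : bdd (fun t => ccos (chi t)).
Proof. by exists 1 => t; rewrite ler_norml ccos_geN1 ccos_le1. Qed.

(** Averaging [ccosDB] shows that the mean is multiplied by [ccos (chi y)], which is not 1, without
    changing. *)
Lemma mean_character chi : zmod_morphism chi -> (exists y, chi y <> 0) ->
  m (fun t => ccos (chi t)) = 0.
Proof.
move=> chiB [y chiy].
have chiD := zmod_morphD chiB.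
have cb := bdd_ccos chi.
have : m (fun t => ccos (chi (t + y)) + ccos (chi (t + - y))) =
    2 * ccos (chi y) * m (fun t => ccos (chi t)).
  rewrite -meanZ//; congr (m _); apply/funext => t.
  by rewrite chiD chiB ccosDB; ring.
have cb' z : bdd (fun t => ccos (chi (t + z))).
  exact: (bdd_shift z cb).
rewrite (meanD m (cb' y) (cb' (- y))) !(mean_shift m _ cb).
move=> e; have : (1 - ccos (chi y)) * m (fun t => ccos (chi t)) = 0 by lra.
move/eqP; rewrite mulf_eq0 subr_eq0 => /predU1P[c1|/eqP//].
by case: chiy; apply: ccos_eq1.
Qed.

End bohr_sets.

(* If chi were not in S, the mean of Q^n cos chi, where Q is the product of the
   (1 + cos psi)/2 for psi in l, would vanish for every n, since it expands into
   means of nontrivial characters; but Q^n concentrates on the Bohr set, where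
   cos chi >= 1/2, as n grows. *)
Lemma bohr_character (R : realType) (G : zmodType) (S : set (G -> circle R))
    (l : seq (G -> circle R)) (e : R) (chi : G -> circle R) :
  (forall psi, S psi -> zmod_morphism psi) -> S 0 ->
  (forall phi psi, S phi -> S psi -> S (phi - psi)) ->
  (forall psi, psi \in l -> S psi) -> 0 < e -> zmod_morphism chi ->
  (forall x, (forall psi, psi \in l -> 1 - ccos (psi x) < e) ->
    2^-1 <= ccos (chi x)) ->
  S chi.
Proof.
move=> SB S0 Ssub lS e_gt0 chiB chil; apply: contrapT => nSchi.
(* This makes [a], which is 1 - e / 2, positive. *)
wlog e1 : e e_gt0 chil / e <= 1.
  move=> H; apply: (H (Num.min e 1)); rewrite ?lt_min ?e_gt0 ?ltr01//.
    move=> x xl; apply: chil => psi psil.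
    by have := xl psi psil; rewrite lt_min => /andP[].
  by rewrite ge_min lexx orbT.
have [m] := mean_exists R G.
pose q (psi : G -> circle R) x : R := (1 + ccos (psi x)) / 2.
have q01 psi x : 0 <= q psi x <= 1.
  by have := ccos_le1 (psi x); have := ccos_geN1 (psi x); rewrite /q; lra.
pose Q x := \prod_(psi <- l) q psi x.
have Q01 x : 0 <= Q x <= 1.
  by apply: prod_itv01 => psi; exact: q01.
have SN psi : S psi -> S (- psi) by move=> Spsi; rewrite -sub0r; apply: Ssub.
have SD phi psi : S phi -> S psi -> S (phi + psi).
  by move=> Sphi /SN Spsi; rewrite -[psi]opprK; apply: Ssub.
(* Functions orthogonal to the cosines of all characters outside [S]. Multiplication by [q psi]
   preserves them: a product of cosines is half the sum of the cosines of phi + psi and phi - psi,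
   which are outside [S] along with phi. *)
pose null (u : G -> R) := bdd u /\ forall psi, zmod_morphism psi ->
  ~ S psi -> m (fun t => u t * ccos (psi t)) = 0.
have null1 : null (fun=> 1).
  split=> [|psi psiB nS]; first exact: bdd_cst.
  under eq_fun => t do rewrite mul1r.
  apply: mean_character => //; apply: contrapT => psi0; apply: nS.
  suff -> : psi = 0 by [].
  by apply/funext => y; apply: contrapT => psiy; apply: psi0; exists y.
have nullM u psi : null u -> S psi -> null (fun t => u t * q psi t).
  move=> [ub u0] Spsi.
  have qb : bdd (q psi) by exact: bdd01.
  split=> [|phi phiB nS]; first exact: bddM.
  have psiB := SB _ Spsi.
  have phipsiB (f : G -> circle R) : zmod_morphism f -> zmod_morphism (phi + f).
    by move=> fB x y; rewrite !fctE fB phiB opprD addrACA.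
  have -> : (fun t => u t * q psi t * ccos (phi t)) = (fun t =>
     2^-1 * (u t * ccos (phi t)) + 4^-1 * (u t * ccos ((phi + psi) t)
       + u t * ccos ((phi + - psi) t))).
    apply/funext => t; have := ccosDB (phi t) (psi t); rewrite /q !fctE.
    by move=> eq; rewrite -[u t * ccos _ + _]mulrDr eq; field.
  have ucb f : bdd (fun t => u t * ccos (f t)).
    by apply: bddM => //; exact: bdd_ccos.
  rewrite meanD ?meanZ ?meanD ?u0 ?addr0 ?mulr0 ?addr0//.
  - by apply: phipsiB => x y; rewrite !fctE psiB opprD.
  - by move=> /SD/(_ Spsi); rewrite subrK.
  - exact: phipsiB.
  - by move=> /Ssub/(_ Spsi); rewrite addrK.
  - exact: bddD.
  - exact: bddM (bdd_cst _ _) (ucb _).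
  - exact: bddM (bdd_cst _ _) (bddD (ucb _) (ucb _)).
have nullP u l' : null u -> (forall psi, psi \in l' -> S psi) ->
    null (fun t => u t * \prod_(psi <- l') q psi t).
  move=> nu; elim: l' => [|psi l' IHl] l'S.
    by under eq_fun => t do rewrite big_nil mulr1.
  under eq_fun => t do rewrite big_cons mulrCA mulrC.
  apply: nullM; last by apply: l'S; rewrite inE eqxx.
  by apply: IHl => phi phil; apply: l'S; rewrite inE phil orbT.
have nullQ n : null (fun t => Q t ^+ n).
  elim: n => [|n IHn]; first by under eq_fun do rewrite expr0.
  by under eq_fun => t do rewrite exprSr; exact: nullP.
pose e' := e / (2 * (size l).+1%:R).
have e'0 : 0 < e' by rewrite divr_gt0// mulr_gt0.
have [F FP] := bohr_cover e'0 (fun psi psil => SB _ (lS psi psil)) setT.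
pose k : R := (size F)%:R^-1.
have k0 : 0 < k.
  by rewrite invr_gt0 ltr0n; have [a []] := FP 0 I; case: F {FP k}.
(* [Q] is at most [a] off the Bohr set of radius [e], and at least [b] on the one of radius [e'],
   whose translates by [F] cover the group. *)
pose b := 1 - e / 4; pose a := 1 - e / 2.
have a0 : 0 < a by rewrite /a; lra.
have ab : a < b by rewrite /a /b; lra.
have [n nP] := eventually_expr_lt a0 ab (divr_gt0 k0 (ltr0n _ 3)).
have QB n' : bdd (fun t => Q t ^+ n').
  by apply: bdd01 => t; case/andP: (Q01 t) => ? ?;
    rewrite exprn_ge0// exprn_ile1.
have QFar x : ~ (forall psi, psi \in l -> 1 - ccos (psi x) < e) -> Q x <= a.
  move=> /existsNP[psi /not_implyP[psil /negP]]; rewrite -leNgt => xe.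
  rewrite /Q (big_rem psi)//=; set P := \prod_(_ <- _) _.
  have /andP[P0 P1] : 0 <= P <= 1 by apply: prod_itv01 => phi; exact: q01.
  have /andP[q0 q1] := q01 psi x.
  by rewrite (le_trans (ler_piMr q0 P1))// /q /a; lra.
have QNear x : (forall psi, psi \in l -> 1 - ccos (psi x) < e') -> b <= Q x.
  move=> xe; have : 1 - (size l)%:R * (e' / 2) <= Q x.
    by apply: prod_ge1B => // psi /xe; rewrite /q; lra.
  apply: le_trans; rewrite lerD2l lerN2 /e'.
  have l0 : (size l)%:R <= (size l).+1%:R :> R by rewrite ler_nat.
  rewrite mulrA ler_pdivrMr// mulrCA -mulrA ler_pM2l//.
  by rewrite invfM mulrCA mulrA ler_pdivrMr//; lra.
have b0 : 0 < b by exact: lt_trans ab.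
have low : k * b ^+ n <= m (fun t => Q t ^+ n).
  have bn : 0 < b ^+ n by rewrite exprn_gt0.
  pose g t := (b ^+ n)^-1 * Q t ^+ n.
  rewrite -ler_pdivlMr// mulrC -(meanZ m _ (QB n)).
  apply: (@mean_cover _ _ m
    [set x | forall psi, psi \in l -> 1 - ccos (psi x) < e']).
  - by move=> x; have [c [cF _ cl]] := FP x I; exists c.
  - exact: bddM (bdd_cst _ _) _.
  - move=> t; have /andP[Q0 _] := Q01 t.
    by rewrite mulr_ge0 ?invr_ge0 ?exprn_ge0// ltW.
  - move=> t /QNear bQ; rewrite mulrC ler_pdivlMr// mul1r.
    have /andP[Q0 _] := Q01 t.
    by rewrite lerXn2r ?nnegrE ?(ltW b0).
(* The integrand is at most Q^n cos chi: on the Bohr set the cosine is at least 1/2; off it, the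
   product is at least - Q^n, and Q^n is at most a^n. *)
have high : 2^-1 * m (fun t => Q t ^+ n) - 3 / 2 * a ^+ n <= 0.
  have [_ /(_ chi chiB nSchi) <-] := nullQ n.
  have Qhalf : bdd (fun t => 2^-1 * Q t ^+ n) by exact: bddM (bdd_cst _ _) _.
  rewrite -[3 / 2 * _](mean_cst m) -(meanZ m _ (QB n)) -(meanB _ Qhalf (bdd_cst
    _ _)).
  apply: ler_mean => [||t].
  - by apply: bddD => //; exact: bdd_cst.
  - by apply: bddM => //; exact: bdd_ccos.
  have /andP[Q0 Q1] := Q01 t; have Qn0 : 0 <= Q t ^+ n by exact: exprn_ge0.
  have an0 : 0 < a ^+ n by rewrite exprn_gt0.
  have c1 := ccos_geN1 (chi t).
  have [/chil|/QFar Qa] :=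
    pselect (forall psi, psi \in l -> 1 - ccos (psi t) < e); first nra.
  have : Q t ^+ n <= a ^+ n by rewrite lerXn2r ?nnegrE ?(ltW a0).
  nra.
suff : k * b ^+ n <= 3 * a ^+ n by move: nP; nra.
lra.
Qed.

(** * States and d'Alembert's equation *)

Section states.
Variables (R : realType) (G : zmodType) (j : G).
Implicit Types (r p : G -> R) (s : seq (R * G)).

(** The quadratic form of the kernel r (g - h) at a list of weighted points; its nonnegativity is
    positive definiteness. *)
Definition energy r s := \sum_(u <- s) \sum_(v <- s) u.1 * v.1 * r (u.2 - v.2).

(* A real-valued model of the normalized positive definite functions on a
   group: with G = A * R and j = (0, pi / 2), the positive definite function q
   on A is represented by r (x, t) = Re (q x * exp (i t)), and adding j amounts
   to multiplying by i. *)
Record state r : Prop := State {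
  state0 : r 0 = 1;
  stateN : forall g, r (- g) = r g;
  state_half_turn : forall g, r (g + (j + j)) = - r g;
  state_energy : forall s, 0 <= energy r s
}.

(** Weights 1 and 1, or 1 and -1, at [g] and 0 have energy 2 + 2 r g, or 2 - 2 r g. *)
Lemma state_norm r g : state r -> `|r g| <= 1.
Proof.
move=> [r0 rN _ rE].
have := rE [:: (1, g); (1, 0)]; have := rE [:: (1, g); (-1, 0)].
rewrite /energy !big_cons !big_nil /= !subrr !subr0 !sub0r rN r0 => h1 h2.
by rewrite ler_norml; lra.
Qed.

(** If r g = <U_g v, v> for a unitary representation U, this is the normalized sum of 2 r and of the
    same function for the vector v + e U_y v; the term 2 r keeps the denominator positive. [r] is a
    convex combination of the cases e = 1 and e = -1, whose agreement at g is d'Alembert's equation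
    for g and y. *)
Definition reflect_mix r (e : R) y : G -> R :=
  fun g => (r g + e / 4 * (r (g + y) + r (g - y))) / (1 + e / 2 * r y).

Lemma reflect_mix_den r e y : state r -> e ^+ 2 = 1 ->
  2^-1 <= 1 + e / 2 * r y.
Proof.
move=> /state_norm - /(_ y); rewrite ler_norml => /andP[r1 r2] /eqP.
by rewrite sqrf_eq1 => /orP[]/eqP->; lra.
Qed.

Lemma reflect_mix_state r e y : state r -> e ^+ 2 = 1 ->
  state (reflect_mix r e y).
Proof.
move=> rS e2; have [r0 rN rj rE] := rS.
have den : 0 < 1 + e / 2 * r y.
  by apply: lt_le_trans (reflect_mix_den y rS e2); rewrite invr_gt0.
split.
- rewrite /reflect_mix add0r sub0r rN r0.
  by rewrite (_ : _ * (_ + _) = e / 2 * r y); [rewrite divff ?gt_eqF|field].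
- move=> g; rewrite /reflect_mix.
  have -> : - g + y = - (g - y) by rewrite opprB addrC.
  by rewrite -opprD !rN [r (g - y) + _]addrC.
- move=> g; rewrite /reflect_mix.
  have -> : g + (j + j) + y = g + y + (j + j) by rewrite addrAC.
  have -> : g + (j + j) - y = g - y + (j + j) by rewrite addrAC.
  rewrite !rj.
  by rewrite -opprD mulrN -opprD mulNr.
move=> s; rewrite /energy.
(* The combination [s] plus [e] times its translate by [y]. *)
pose s' := s ++ [seq (e * u.1, u.2 + y) | u <- s].
have -> : \sum_(u <- s) \sum_(v <- s) u.1 * v.1 * reflect_mix r e y (u.2 - v.2)
    = (2 * energy r s + energy r s') / (4 * (1 + e / 2 * r y)).
  rewrite /energy /s' big_cat /= big_map -big_split /= mulr_sumr -big_split /=.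
  rewrite mulr_suml; apply: eq_bigr => u _.
  rewrite !big_cat /= !big_map -!big_split /= mulr_sumr -big_split /= mulr_suml.
  apply: eq_bigr => v _ /=; rewrite /reflect_mix.
  have -> : u.2 - (v.2 + y) = u.2 - v.2 - y by rewrite opprD addrA.
  have -> : u.2 + y - v.2 = u.2 - v.2 + y by rewrite addrAC.
  have -> : u.2 + y - (v.2 + y) = u.2 - v.2 by rewrite opprD addrACA subrr
    addr0.
  have -> : e * u.1 * (e * v.1) = u.1 * v.1 by rewrite mulrACA -expr2 e2 mul1r.
  by field; rewrite gt_eqF//; nra.
by rewrite divr_ge0 ?addr_ge0 ?mulr_ge0 ?rE// ltW.
Qed.

Definition dalembert r g := forall y, r (g + y) + r (g - y) = 2 * r g * r y.

Section limits.
Variables (I : Type) (U : set_system I).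
Hypothesis UU : UltraFilter U.

Lemma cvg_seq_sum (T : Type) (s : seq T) (f : T -> I -> R) (l : T -> R) :
  (forall t, f t i @[i --> U] --> l t) ->
  \sum_(t <- s) f t i @[i --> U] --> \sum_(t <- s) l t.
Proof.
move=> fl; elim: s => [|t s IHs].
  by under eq_fun do rewrite big_nil; rewrite big_nil; exact: cvg_cst.
by under eq_fun do rewrite big_cons; rewrite big_cons; exact: cvgD.
Qed.

(** Values of states are bounded by 1, so ultralimits exist, and the laws of a state pass to
    pointwise limits. *)
Lemma state_limit (r_ : I -> G -> R) : (forall i, state (r_ i)) ->
  exists2 r, state r & forall g, r_ i g @[i --> U] --> r g.
Proof.
move=> rS; have /choice[r rl] : forall g, exists l : R, r_ i g @[i --> U] --> l.
  by move=> g; apply: (@ultra_bounded_cvg _ _ _ _ _ 1) => i; exact: state_norm.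
have lim_eq (f h : I -> R) (a b : R) :
    f @ U --> a -> h @ U --> b -> f =1 h -> a = b.
  by move=> fa hb /funext fh; rewrite fh in fa; exact: (cvg_unique _ fa hb).
exists r => //; split.
- by apply: (lim_eq _ (fun=> 1) _ _ (rl 0)) => [|i];
    [exact: cvg_cst|exact: state0].
- by move=> g; apply: (lim_eq _ _ _ _ (rl (- g)) (rl g)) => i; exact: stateN.
- move=> g; apply: (lim_eq _ _ _ _ (rl (g + (j + j))) (cvgN (rl g))) => i.
  exact: state_half_turn.
- move=> s; suff /cvgr_to_ge : energy (r_ i) s @[i --> U] --> energy r s.
    by apply; apply: filterE => i; exact: state_energy.
  apply: cvg_seq_sum => u; apply: cvg_seq_sum => v.
  by apply: cvgMr; exact: rl.
Qed.

End limits.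

(* The functional minimized in the proof is affine minus a strictly convex
   function of the values on E, so that a minimizer is not a proper mixture of
   two states with different values on E. *)
Lemma dalembert_state (w : seq (R * G)) (E : seq G) p (e : R) :
  state p -> 0 < e -> exists r, [/\ state r,
    \sum_(u <- w) u.1 * r u.2 <= \sum_(u <- w) u.1 * p u.2 + e &
    forall g, g \in E -> dalembert r g].
Proof.
move=> pS e_gt0.
pose L r := \sum_(u <- w) u.1 * r u.2; pose N r := \sum_(g <- E) r g ^+ 2.
(* This makes the concave term at most [e] on states. *)
pose eta := e / (size E).+1%:R.
have eta0 : 0 < eta by rewrite divr_gt0.
pose J r := L r - eta * N r.
have N_ge0 r : 0 <= N r by apply: sumr_ge0 => g _; exact: sqr_ge0.
have N_le r : state r -> N r <= (size E)%:R.
  move=> rS; rewrite -[leRHS]mulr_natl mulr1 -sum1_size natr_sum.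
  apply: ler_sum => g _; have := state_norm g rS; rewrite ler_norml; nra.
pose V := [set J r | r in state].
have VI : has_inf V.
  split; first by exists (J p), p.
  exists (- \sum_(u <- w) `|u.1| - eta * (size E)%:R) => _ [r rS <-].
  rewrite lerB ?ler_pM2l ?N_le// -sumrN; apply: ler_sum => u _.
  rewrite (le_trans _ (lerNnormlW (lexx _)))// lerN2 normrM.
  by rewrite ler_piMr// state_norm.
have /choice[r_ r_P] : forall n : nat, exists r,
    state r /\ J r < inf V + n.+1%:R^-1.
  move=> n; have [|_ [r rS <-] Jr] := @inf_adherent _ V n.+1%:R^-1 _ VI.
    by rewrite invr_gt0.
  by exists r.
(* An ultralimit of the minimizing sequence attains the infimum. *)
have [U [UU ooU]] := ultraFilterLemma (eventually_filter).
have [r rS rl] := state_limit UU (fun n => (r_P n).1).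
have Jr : J r <= inf V.
  apply/ler_addgt0Pr => d d0.
  have Jl : J (r_ n) @[n --> U] --> J r.
    apply: cvgB; first by apply: cvg_seq_sum => u; apply: cvgMr.
    apply: cvgMr; apply: cvg_seq_sum => g.
    by under eq_fun do rewrite expr2; rewrite expr2; apply: cvgM.
  apply: (cvgr_to_le Jl); apply: ooU.
  exists (Num.truncn d^-1) => // n /= dn.
  rewrite (le_trans (ltW (r_P n).2))// lerD2l invf_ple ?posrE//.
  by rewrite (le_trans (ltW (truncnS_gt _)))// ler_nat.
have Jmin q : state q -> J r <= J q.
  move=> qS; apply: le_trans Jr _; apply: ge_inf; first exact: VI.2.
  by exists q.
exists r; split => //.
  have := Jmin _ pS; rewrite /J -/(L r) -/(L p).
  have := N_le _ rS; have := N_ge0 p.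
  have : eta * (size E).+1%:R = e by rewrite divfK ?pnatr_eq0.
  rewrite -natr1; nra.
move=> g gE y.
have q1S : state (reflect_mix r 1 y) by apply: reflect_mix_state;
  rewrite ?expr1n.
have q2S : state (reflect_mix r (-1) y).
  by apply: reflect_mix_state; rewrite ?sqrrN ?expr1n.
have a0 : 2^-1 <= 1 + 1 / 2 * r y by apply: reflect_mix_den; rewrite ?expr1n.
have b0 : 2^-1 <= 1 + -1 / 2 * r y.
  by apply: reflect_mix_den; rewrite ?sqrrN ?expr1n.
move: (Jmin _ q1S) (Jmin _ q2S); rewrite /J.
set q1 := reflect_mix r 1 y in q1S *; set q2 := reflect_mix r (-1) y in q2S *.
have q1E h : q1 h * (1 + 1 / 2 * r y) = r h + 1 / 4 * (r (h + y) + r (h - y)).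
  by rewrite /q1 /reflect_mix divfK// gt_eqF//; lra.
have q2E h : q2 h * (1 + -1 / 2 * r y) = r h + -1 / 4 * (r (h + y) + r (h - y)).
  by rewrite /q2 /reflect_mix divfK// gt_eqF//; lra.
clearbody q1 q2.
have rE h : r h = (q1 h * (1 + 1 / 2 * r y) + q2 h * (1 + -1 / 2 * r y)) / 2.
  by rewrite q1E q2E; field.
set a := 1 + 1 / 2 * r y in a0 q1E rE.
set b := 1 + -1 / 2 * r y in b0 q2E rE.
have ab : a + b = 2 by rewrite /a /b; field.
have bE : b = 1 + -1 / 2 * r y by [].
clearbody a b.
have ba : b = 2 - a by rewrite -ab [a + b]addrC addrK.
have a_gt0 : 0 < a by apply: lt_le_trans a0; rewrite invr_gt0.
have b_gt0 : 0 < b by apply: lt_le_trans b0; rewrite invr_gt0.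
have LE : L r = a / 2 * L q1 + b / 2 * L q2.
  rewrite /L !mulr_sumr -big_split /=; apply: eq_bigr => u _.
  by rewrite (rE u.2); field.
(* The strict convexity of [N]: the mixture of [N q1] and [N q2] exceeds [N r] by a b D / 4. *)
pose D := \sum_(h <- E) (q1 h - q2 h) ^+ 2.
have NE : N r = a / 2 * N q1 + b / 2 * N q2 - a * b / 4 * D.
  rewrite /N /D !mulr_sumr -sumrN -!big_split /=; apply: eq_bigr => h _.
  by rewrite (rE h) ba; field.
(* Mixing the two minimality inequalities with weights a / 2 and b / 2 cancels everything but the
   term in [D]. *)
move=> J1 J2; have D0 : D <= 0.
  have abe : 0 < a * b * eta / 4 by rewrite divr_gt0// mulr_gt0// mulr_gt0.
  rewrite -(pmulr_rle0 _ abe).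
  have aJ : 0 <= a / 2 * (L q1 - eta * N q1 - (L r - eta * N r)).
    by rewrite mulr_ge0 ?subr_ge0// divr_ge0// ltW.
  have bJ : 0 <= b / 2 * (L q2 - eta * N q2 - (L r - eta * N r)).
    by rewrite mulr_ge0 ?subr_ge0// divr_ge0// ltW.
  have := addr_ge0 aJ bJ; rewrite LE NE -oppr_ge0; congr (0 <= _).
  by rewrite ba; field.
have : (q1 g - q2 g) ^+ 2 <= D.
  rewrite /D (big_rem g)//= ler_wpDr//.
  by apply: sumr_ge0 => h _; exact: sqr_ge0.
move=> /le_trans/(_ D0) q12.
(* Both values then equal [r g], and [q2E] becomes d'Alembert's equation. *)
have /eqP : q1 g - q2 g = 0.
  by apply/eqP; rewrite -sqrf_eq0 eq_le q12 sqr_ge0.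
rewrite subr_eq0 => /eqP qe.
have rq : r g = q2 g by rewrite (rE g) qe -mulrDr ab mulfK ?pnatr_eq0.
by have := q2E g; rewrite -rq bE; lra.
Qed.

(** Along growing lists [E], each equation and each eventual bound passes to the ultralimit. *)
Lemma dalembert_limit (r_ : seq G -> G -> R) :
  (forall E, state (r_ E)) ->
  (forall E g, g \in E -> dalembert (r_ E) g) ->
  exists r, [/\ state r, forall g, dalembert r g,
    forall g c, (\forall E \near @cofinal_seqs G, r_ E g <= c) -> r g <= c &
    forall g c, (\forall E \near @cofinal_seqs G, c <= r_ E g) -> c <= r g].
Proof.
move=> rS rdA; have [U [UU FU]] := ultraFilterLemma (@cofinal_seqs_filter G).
have [r r_state rl] := state_limit UU rS; exists r; split => //.
- move=> g y; have : r_ E (g + y) + r_ E (g - y) @[E --> U] -->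
    r (g + y) + r (g - y) by exact: cvgD.
  have : 2 * r_ E g * r_ E y @[E --> U] --> 2 * r g * r y.
    by apply: cvgM => //; exact: cvgMr.
  move=> l2 l1; apply: (cvg_unique _ l1) => //.
  apply: cvg_trans l2; apply: near_eq_cvg; apply: FU.
  apply: filterS (cofinal_seqs_sub [:: g]) => E gE.
  by rewrite rdA// gE// inE.
- by move=> g c /FU rc; exact: (cvgr_to_le (rl g) rc).
- by move=> g c /FU rc; exact: (cvgr_to_ge (rl g) rc).
Qed.

(** [t] is the sine that goes with [r]: d'Alembert's equation and the half turn law give r^2 + t^2 =
    1 and both addition formulas, so the point (r g, t g) of the unit circle depends additively on
    g. *)
Lemma dalembert_character r : state r -> (forall g, dalembert r g) ->
  exists2 chi : G -> circle R, zmod_morphism chi & forall g, ccos (chi g) = r g.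
Proof.
move=> [r0 rN rj _] rdA; pose t g := r (g - j).
have rjj g : r (g - (j + j)) = - r g.
  by rewrite -[g in RHS](subrK (j + j)) rj opprK.
have rt1 g : r g ^+ 2 + t g ^+ 2 = 1.
  have := rdA g g; have := rdA (g - j) (g - j).
  rewrite !subrr r0 addrACA -opprD.
  by rewrite -/(t g) rjj => *; rewrite !expr2; lra.
have rD g h : r (g + h) = r g * r h - t g * t h.
  have := rdA g h; have := rdA (g - j) (h - j).
  rewrite addrACA -opprD rjj opprB addrA subrK -/(t g) -/(t h).
  by move=> *; lra.
have tD g h : t (g + h) = t g * r h + r g * t h.
  have := rdA g (h - j); have := rdA (g - j) h.
  rewrite /t; have -> : g - j + h = g + h - j by rewrite addrAC.
  have -> : g - (h - j) = g - j - h + (j + j).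
    by rewrite opprB addrA [g - j - h]addrAC [RHS]addrA subrK addrAC.
  rewrite rj addrA => *; lra.
have /choice[chi chiP] : forall g, exists c : circle R,
  ccos c = r g /\ csin c = t g.
  by move=> g; exact: circle_point.
have chiD g h : chi (g + h) = chi g + chi h.
  have [gc gs] := chiP g; have [hc hs] := chiP h; have [c s] := chiP (g + h).
  apply: circle_inj; first by rewrite c rD ccosD gc gs hc hs.
  by rewrite s tD csinD gc gs hc hs.
exists chi => [g h|g]; last by case: (chiP g).
by have := chiD (g - h) h; rewrite subrK => ->; rewrite addrK.
Qed.

End states.

(** * Characters of precompact groups *)

Section character_existence.
Variables (R : realType) (G : zmodType).
Implicit Types (p : G -> R).

Definition quarter_turn : G * R := (0, pi / 2).

(** By the formula for cos (t - t'), the energy of the extension is a sum of two energies of [p]. *)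
Lemma state_extension p : p 0 = 1 -> (forall x, p (- x) = p x) ->
  (forall s, 0 <= energy p s) ->
  state quarter_turn (fun z : G * R => p z.1 * cos z.2).
Proof.
move=> p0 pN pE; split => [|[x t]|[x t]|s] /=.
- by rewrite p0 cos0 mulr1.
- by rewrite pN cosN.
- by rewrite addr0 addr0 -splitr cosDpi mulrN.
have -> : energy (fun z : G * R => p z.1 * cos z.2) s =
    energy p [seq (u.1 * cos u.2.2, u.2.1) | u <- s] +
    energy p [seq (u.1 * sin u.2.2, u.2.1) | u <- s].
  rewrite /energy !big_map -big_split; apply: eq_bigr => u _.
  rewrite !big_map -big_split; apply: eq_bigr => v _ /=.
  by rewrite cosB; ring.
by rewrite addr_ge0.
Qed.

(** The indicator of 0 is positive definite and vanishes at [x]. Its approximations by solutions of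
    d'Alembert's equation are at most 1/2 at (x, 0), and so is the cosine of the limiting
    character. *)
Lemma character_separation (x : G) : x != 0 ->
  exists2 chi : G -> circle R, zmod_morphism chi & chi x <> 0.
Proof.
move=> x0; pose p (y : G) : R := (y == 0)%:R.
have pS : state quarter_turn (fun z : G * R => p z.1 * cos z.2).
  apply: state_extension => [|y|s]; first by rewrite /p eqxx.
    by rewrite /p oppr_eq0.
  (* Grouped by points, the energy is the sum of the squares of the total weights. *)
  have -> : energy p s = \sum_(z <- undup [seq u.2 | u <- s])
      (\sum_(u <- s) u.1 * (u.2 == z)%:R) ^+ 2.
    under eq_bigr => z _.
      rewrite expr2 mulr_suml; under eq_bigr => u _ do rewrite mulr_sumr.
      over.
    rewrite exchange_big /energy /=; apply: eq_big_seq => u us.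
    rewrite exchange_big /=; apply: eq_bigr => v _.
    rewrite (bigD1_seq u.2) ?undup_uniq ?mem_undup ?map_f//= eqxx mulr1.
    rewrite big1 => [|z /negPf zu]; last by rewrite eq_sym zu mulr0 mul0r.
    by rewrite addr0 mulrA /p subr_eq0 eq_sym.
  by apply: sumr_ge0 => z _; exact: sqr_ge0.
have /choice[r_ r_P] : forall E : seq (G * R), exists r : G * R -> R,
    [/\ state quarter_turn r, r (x, 0) <= 2^-1 &
      forall g, g \in E -> dalembert r g].
  move=> E; have [|r [rS rx rE]] :=
    @dalembert_state _ _ _ [:: (1, (x, 0))] E _ 2^-1 pS;
      first by rewrite invr_gt0.
  exists r; split => //; move: rx; rewrite !big_seq1 /= /p (negPf x0) !mul1r.
  by rewrite mul0r add0r.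
have [|E g gE|r [rS rdA rle _]] := @dalembert_limit _ _ quarter_turn r_.
- by move=> E; case: (r_P E).
- by case: (r_P E) => _ _; apply.
have [chi chiB chir] := dalembert_character rS rdA.
exists (fun y => chi (y, 0)) => [y z|chix].
  by rewrite -chiB; congr (chi _); congr (_, _); rewrite subr0.
have : r (x, 0) <= 2^-1.
  by apply: rle; apply: filterE => E; case: (r_P E).
by rewrite -chir chix ccos0 invf_ge1// lern1.
Qed.

End character_existence.

(** The neighbourhoods of 0 in a group topology, given as a bare filter so that the results also
    apply to a topology pulled back from a compact group. *)
Record group_nbhs (G : zmodType) (N : set_system G) : Prop := GroupNbhs {
  group_nbhs_filter : Filter N;
  group_nbhs0 : forall U, N U -> U 0;
  group_nbhsB : forall U, N U ->
    exists2 V, N V & forall v w, V v -> V w -> U (v - w)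
}.

Definition totally_bounded (G : zmodType) (N : set_system G) :=
  forall U, N U -> exists F : seq G, forall x, exists2 a, a \in F & U (x - a).

Section precompact_duality.
Variables (R : realType) (G : zmodType) (N : set_system G).
Hypotheses (NG : group_nbhs N) (NF : totally_bounded N).

Let N_filter : Filter N := group_nbhs_filter NG.
#[local] Existing Instance N_filter.

Lemma group_nbhsD U : N U -> exists V, [/\ N V, forall v, V v -> V (- v) &
  forall v w, V v -> V w -> U (v + w)].
Proof.
move=> /(group_nbhsB NG)[V0 NV0 V0U].
have [V1 NV1 V1V0] := group_nbhsB NG NV0.
have V10 := group_nbhs0 NG NV1.
exists [set v | V0 v /\ V0 (- v)]; split => /=.
- apply: filterS NV1 => v Vv; split; first by rewrite -[v]subr0; exact: V1V0.
  by rewrite -sub0r; exact: V1V0.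
- by move=> v [? ?]; rewrite opprK.
- by move=> v w [Vv _] [_ Vw]; rewrite -[w]opprK; exact: V0U.
Qed.

(** [B k] contains the sums of [k] elements of [V]; repeated halving of [W] keeps them inside it. *)
Lemma group_nbhs_chain n W : N W -> exists V (B : nat -> set G),
  [/\ N V, forall v, V v -> V (- v), B 0%N = [set 0],
      forall k, (k < n)%N -> forall b v, B k b -> V v -> B k.+1 (b + v) &
      forall k, (k <= n)%N -> B k `<=` W].
Proof.
elim: n W => [|n IHn] W NW.
  have [V [NV Vsym _]] := group_nbhsD NW.
  exists V, (fun=> [set 0]); split => // k _ _ ->; exact: group_nbhs0 NW.
have [W' [NW' W'sym W'W]] := group_nbhsD NW.
have [V [B [NV Vsym B0 BV BW']]] := IHn W' NW'.
exists (V `&` W'), (fun k => if k == n.+1 then W else B k); split => /=.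
- exact: filterI.
- by move=> v [/Vsym ? /W'sym ?].
- by [].
- move=> k; rewrite ltnS eqSS => kn b v; rewrite ltn_eqF ?ltnS// => Bb [Vv W'v].
  case: eqP => [kn'|/eqP kn']; last by apply: BV => //; rewrite ltn_neqAle kn'.
  by apply: W'W => //; apply: (BW' k).
- move=> k; rewrite leq_eqVlt => /predU1P[->|kn]; first by rewrite eqxx.
  rewrite ltn_eqF// => b /BW'; rewrite -ltnS => /(_ kn) W'b.
  by rewrite -[b]addr0; apply: W'W => //; exact: group_nbhs0 NW'.
Qed.

(** [f t] is the proportion of the indices k <= n with t in [A k], that is, in W + B k; translation
    by [V] shifts the index by one. [W] comes before [n], because [n] will be chosen from the number
    of translates of [W] that cover the group. *)
Lemma bump U : N U -> exists2 W, N W & forall n, exists V (f : G -> R),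
  [/\ N V, forall t, 0 <= f t <= 1, forall t, W t -> f t = 1,
      forall t, ~ U t -> f t = 0 &
      forall y t, V y -> `|f (t + y) - f t| <= n.+1%:R^-1].
Proof.
move=> /group_nbhsD[W [NW _ WU]]; exists W => // n.
have [V [B [NV Vsym B0 BV BW]]] := group_nbhs_chain n.+1 NW.
have V0 := group_nbhs0 NG NV.
pose A k := [set w + b | w in W & b in B k].
have AV k t v : (k <= n)%N -> A k t -> V v -> A k.+1 (t + v).
  move=> kn [w Ww [b Bb <-]] Vv; exists w => //; exists (b + v);
    last exact: addrA.
  exact: BV.
pose S t := \sum_(0 <= k < n.+1) (t \in A k)%:R : R.
have Sshift t v : V v -> S t <= S (t + v) + 1.
  move=> Vv; apply: (@le_trans _ _ (\sum_(0 <= k < n.+1) (t + v \in A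
    k.+1)%:R)).
    rewrite /S !big_mkord; apply: ler_sum => k _.
    rewrite ler_nat; case: (boolP (t \in A k)) => // /set_mem At.
    by rewrite mem_set//; apply: AV => //; rewrite -ltnS.
  rewrite -(big_add1 _ _ 0 n.+2 xpredT (fun k => (t + v \in A k)%:R)).
  rewrite big_nat_recr//= /S [in leRHS]big_ltn//=.
  have : (t + v \in A n.+1)%:R <= 1 :> R by rewrite lern1 leq_b1.
  have : 0 <= (t + v \in A 0%N)%:R :> R by exact: ler0n.
  lra.
exists V, (fun t => n.+1%:R^-1 * S t); split => //.
- move=> t; apply/andP; split; first by apply: mulr_ge0;
    [rewrite invr_ge0|apply: sumr_ge0].
  rewrite mulrC ler_pdivrMr// mul1r /S big_mkord.
  rewrite (le_trans (ler_sum _ (fun k _ => _ : _ <= 1)))//.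
    by move=> k _; rewrite lern1 leq_b1.
  by rewrite sumr_const card_ord.
- move=> t Wt; rewrite /S big_mkord.
  under eq_bigr => k _.
    rewrite mem_set; last first.
      exists t => //; exists 0; last exact: addr0.
      elim: (k : nat) (ltn_ord k) => [|i IHi] iN; first by rewrite B0.
      by rewrite -[0]addr0; apply: BV => //; [exact: ltnW|exact/IHi/ltnW].
    over.
  by rewrite sumr_const card_ord mulVf// pnatr_eq0.
- move=> t nUt; rewrite /S big_mkord big1 ?mulr0// => k _.
  rewrite memNset// => -[w Ww [b Bb wb]]; apply: nUt; rewrite -wb.
  by apply: WU => //; apply: BW Bb; exact/ltnW/ltn_ord.
move=> v t Vv; rewrite -mulrBr normrM ger0_norm ?invr_ge0// mulrC.
rewrite ler_piMl ?invr_ge0//.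
have := Sshift t _ Vv; have := Sshift (t + v) _ (Vsym _ Vv); rewrite addrK.
by move=> *; rewrite ler_norml; lra.
Qed.

(* The function is the correlation of a bump function with itself. *)
Lemma concentrated_positive_definite U : N U -> exists (p : G -> R) (V : set G),
  [/\ [/\ N V, p 0 = 1 & forall x, p (- x) = p x],
      forall s, 0 <= energy p s, forall x, ~ U x -> p x = 0 &
      forall y, V y -> 1 - p y <= 128^-1].
Proof.
move=> /group_nbhsD[W0 [NW0 W0sym W0U]].
have [W1 NW1 W1P] := bump NW0.
have [F FP] := NF NW1; have [m] := mean_exists R G.
pose k : R := (size F)%:R^-1.
have F0 : (0 < size F)%N by have [a] := FP 0; case: F {FP k}.
have k0 : 0 < k by rewrite invr_gt0 ltr0n.
have k1 : k <= 1 by rewrite invf_ple ?posrE ?ltr0n// invr1 ler1n.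
(* [k] is a lower bound for the mean [M] of f^2, so the variation of [f] under [V] is small compared
   with [M]. *)
pose n := Num.truncn (8 / k).
have nk : n.+1%:R^-1 <= k / 8.
  rewrite -[k / 8]invrK lef_pV2 ?posrE ?invr_gt0 ?divr_gt0// invf_div ltW//.
  exact: truncnS_gt.
have [V [f [NV f01 fW1 fW0 fV]]] := W1P n.
have fb : bdd f by exact: bdd01.
have fsb y : bdd (fun t => f (t + y)) by exact: bdd_shift.
have ffb y : bdd (fun t => f t * f (t + y)) by exact: bddM.
pose M := m (fun t => f t * f t).
have kM : k <= M.
  apply: (mean_cover m FP); first exact: bddM.
    by move=> t; case/andP: (f01 t) => f0 _; rewrite mulr_ge0.
  by move=> t /fW1->; rewrite mulr1.
have M0 : 0 < M by exact: lt_le_trans kM.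
have corr x y : m (fun t => f (t + x) * f (t + y)) =
    m (fun t => f t * f (t + (x - y))).
  rewrite -(mean_shift m (- y) (bddM (fsb x) (fsb y))).
  congr (m _); apply/funext => t; rewrite subrK mulrC; congr (_ * f _).
  by rewrite -addrA [- y + x]addrC.
exists (fun x => m (fun t => f t * f (t + x)) / M), V; split; first split => //.
- under eq_fun => t do rewrite addr0.
  by rewrite divff// gt_eqF.
- move=> x; congr (_ / _).
  by rewrite -sub0r -corr; congr (m _); apply/funext => t; rewrite addr0.
(* The energy is the mean of the square of a combination of translates of [f], divided by [M]. *)
- move=> s; rewrite /energy.
  have -> : \sum_(u <- s) \sum_(v <- s)
      u.1 * v.1 * (m (fun t => f t * f (t + (u.2 - v.2))) / M) =
      m (fun t => (\sum_(u <- s) u.1 * f (t + u.2)) ^+ 2) / M.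
    have b1 u v : bdd (fun t => u.1 * v.1 * (f (t + u.2) * f (t + v.2))).
      by apply: bddM; [exact: bdd_cst|exact: bddM].
    have -> : (fun t => (\sum_(u <- s) u.1 * f (t + u.2)) ^+ 2) = fun t =>
        \sum_(u <- s) \sum_(v <- s) u.1 * v.1 * (f (t + u.2) * f (t + v.2)).
      apply/funext => t; rewrite expr2 mulr_suml; apply: eq_bigr => u _.
      by rewrite mulr_sumr; apply: eq_bigr => v _; rewrite mulrACA.
    rewrite mean_sum => [|u]; last by apply: bdd_sum => v.
    rewrite mulr_suml; apply: eq_bigr => u _.
    rewrite mean_sum// mulr_suml; apply: eq_bigr => v _.
    by rewrite (meanZ m (u.1 * v.1) (bddM (fsb u.2) (fsb v.2))) corr mulrA.
  rewrite divr_ge0 ?(ltW M0)//; apply: mean_ge0 => [|t]; last exact: sqr_ge0.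
  under eq_fun do rewrite expr2; apply: bddM; apply: bdd_sum => u;
    by apply: bddM => //; exact: bdd_cst.
- move=> x nUx; rewrite (_ : (fun t => _) = fun=> 0) ?mean_cst ?mul0r//.
  apply/funext => t; have [W0t|/fW0->] := pselect (W0 t); last by rewrite mul0r.
  have [W0tx|/fW0->] := pselect (W0 (t + x)); last by rewrite mulr0.
  case: nUx; have -> : x = (t + x) + - t by rewrite addrAC subrr add0r.
  by apply: W0U => //; exact: W0sym.
move=> y Vy.
have : m (fun t => (f (t + y) - f t) ^+ 2) = 2 * M - 2 * m (fun t => f t * f (t
  + y)).
  have -> : (fun t => (f (t + y) - f t) ^+ 2) = fun t =>
      (f (t + y) * f (t + y) + f t * f t) - 2 * (f t * f (t + y)).
    by apply/funext => t; ring.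
  rewrite meanB; [|exact: bddD (bddM (fsb y) (fsb y)) (bddM fb fb)
                 |exact: bddM (bdd_cst _ _) (ffb y)].
  rewrite (meanD m (bddM (fsb y) (fsb y)) (bddM fb fb)) (meanZ m 2 (ffb y)).
  by rewrite corr subrr /M; under eq_fun do rewrite addr0; ring.
set c := m (fun t => f t * f (t + y)) => mE.
(* The left side is 2 M (1 - p y); as k <= M and k <= 1, this gives 1 - p y <= 1/128. *)
have : m (fun t => (f (t + y) - f t) ^+ 2) <= (k / 8) ^+ 2.
  rewrite -[leRHS](mean_cst m); apply: ler_mean; last first.
  - move=> t; rewrite -real_normK ?num_real// lerXn2r ?nnegrE ?normr_ge0//.
      by rewrite divr_ge0// ltW.
    by rewrite (le_trans (fV y t Vy)).
  - exact: bdd_cst.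
  - by under eq_fun do rewrite expr2; apply: bddM; exact: bddB.
rewrite mE => cM; rewrite -(ler_pM2r M0) mulrBl mul1r divfK ?gt_eqF//.
nra.
Qed.

(** When cos u >= 0, 1 - cos (2 u) is at least 2 (1 - cos u); hence each halving of the
    neighbourhood halves the bound. *)
Lemma near_character_continuous (V : set G) (chi : G -> circle R) :
  N V -> zmod_morphism chi -> (forall y, V y -> 1 - ccos (chi y) <= 1) ->
  forall O, nbhs (0 : circle R) O -> N (chi @^-1` O).
Proof.
move=> NV chiB Vchi O /ccos_near0[e e0 eO].
have VnP n : exists2 Vn, N Vn & forall y, Vn y -> 1 - ccos (chi y) <= 2^-1 ^+ n.
  elim: n => [|n [Vn NVn VnP]]; first by exists V => // y; rewrite expr0;
    exact: Vchi.
  have [W [NW _ WVn]] := group_nbhsD NVn.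
  exists (V `&` W); first exact: filterI.
  move=> y [/Vchi y1 Wy]; have := VnP _ (WVn y y Wy Wy).
  rewrite (zmod_morphD chiB) ccosD; have := ccos2Dcsin2 (chi y).
  have : 0 <= ccos (chi y) * (1 - ccos (chi y)).
    by rewrite mulr_ge0 ?subr_ge0 ?ccos_le1//; lra.
  by rewrite [2^-1 ^+ n.+1]exprS; set a := _ ^+ n; lra.
have q1 : `|2^-1 : R| < 1 by rewrite ger0_norm ?invr_ge0// invf_lt1// ltr1n.
have /cvgrPdist_lt/(_ e e0)[n _ /(_ n (leqnn n))] := cvg_expr q1.
rewrite sub0r normrN ger0_norm ?exprn_ge0 ?invr_ge0// => ne.
have [Vn NVn VnP'] := VnP n.
by apply: filterS NVn => y /VnP' ye; apply: eO; exact: le_lt_trans ne.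
Qed.

(* The functional 8 m(f (1 - r)) - m(f) (1 - r x), with m the average over a
   Folner set and f a bump function supported near 0, is negative at the state
   given by a positive definite function p with p x = 0 that is close to 1 on
   the support of f; a d'Alembert state r at which it is almost as small
     satisfies
   r x <= 1/2 and, by the near invariance of m and f, is close to 1 near 0. *)
Lemma separating_character U : N U -> exists2 V, N V &
  forall x, ~ U x -> exists2 chi : G -> circle R, zmod_morphism chi &
    (forall y, V y -> 1 - ccos (chi y) <= 32^-1) /\ 2^-1 <= 1 - ccos (chi x).
Proof.
move=> /concentrated_positive_definite[p [V [[NV p0 pN] pE pU pV]]].
have [W NW WP] := bump NV; have [F FW] := NF NW.
pose k : R := (size F)%:R^-1.
have F0 : (0 < size F)%N by have [a] := FW 0; case: F {FW k}.
have k0 : 0 < k by rewrite invr_gt0 ltr0n.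
have k1 : k <= 1 by rewrite invf_ple ?posrE ?ltr0n// invr1 ler1n.
pose n := Num.truncn (512 / k).
have nk : n.+1%:R^-1 <= k / 512.
  rewrite -[k / 512]invrK lef_pV2 ?posrE ?invr_gt0 ?divr_gt0// invf_div ltW//.
  exact: truncnS_gt.
have [V' [f [NV' f01 fW fV0 fV]]] := WP n.
have [d dE] : exists d : R, d = n.+1%:R^-1 by exists n.+1%:R^-1.
rewrite -dE in nk fV; exists V' => // x nUx.
have pS := state_extension p0 pN pE.
have /choice[r_ r_P] : forall E : seq (G * R), exists r : G * R -> R,
    [/\ state (quarter_turn R G) r, forall g, g \in E -> dalembert r g,
     r (x, 0) <= 2^-1 &
     forall y, V' y -> (y, 0) \in E -> 1 - 32^-1 <= r (y, 0)].
  move=> E; pose Y := [seq g.1 | g <- E].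
  (* Translations by [y] and [- y] serve the estimate near 0, those by [- a] the lower bound on
     [A]. *)
  have [s s0 sP] := folner R (Y ++ [seq - y | y <- Y] ++ [seq - a | a <- F]) n.
  rewrite -dE in sP.
  have f1 t : `|f t| <= 1 by case/andP: (f01 t) => f0 f1; rewrite ger0_norm.
  pose A := avg s f.
  (* The translates of [f] by [F] add up to at least 1, and each has average at most A + 2 d. *)
  have kA : k / 2 <= A.
    have : 1 <= \sum_(a <- F) (A + 2 * d).
      rewrite -[leLHS](avg_cst 1 s0).
      apply: (@le_trans _ _ (\sum_(a <- F) avg s (fun t => f (t + - a)))).
        rewrite /avg -mulr_sumr exchange_big /= ler_wpM2l ?invr_ge0//.
        apply: ler_sum => t _; have [a aF Wta] := FW t.
        rewrite (big_rem a)//= fW// ler_wpDr// sumr_ge0// => b _.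
        by case/andP: (f01 (t - b)).
      rewrite big_seq [leRHS]big_seq; apply: ler_sum => a aF.
      have aI : - a \in Y ++ [seq - y | y <- Y] ++ [seq - a | a <- F].
        by rewrite !mem_cat (map_f (fun a => - a) aF) !orbT.
      have := sP _ aI _ _ f1; rewrite mulr1 -/A ler_norml => /andP[_].
      by rewrite lerBlDl.
    rewrite big_const_seq count_predT iter_addr_0 -[_ *+ _]mulr_natl.
    rewrite -ler_pdivrMl ?ltr0n// mulr1 -/k; lra.
  have A0 : 0 < A by lra.
  pose w := (A, (x, 0 : R)) :: [seq (- (8 * (size s)%:R^-1 * f t), (t,
    0 : R)) | t <- s].
  have wE (r : G * R -> R) : \sum_(u <- w) u.1 * r u.2 =
      A * r (x, 0) - 8 * avg s (fun t => f t * r (t, 0)).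
    rewrite /w big_cons big_map /avg mulrA mulr_sumr -sumrN; congr (_ + _).
    by apply: eq_bigr => t _ /=; rewrite mulNr mulrA.
  have [|r [rS rw rE]] := @dalembert_state _ _ _ w E _ (k / 8) pS.
    by rewrite divr_gt0.
  have r1 g : -1 <= r g <= 1 by rewrite -ler_norml; exact: state_norm rS.
  move: rw; rewrite wE (wE (fun z => p z.1 * cos z.2)) /= pU// mul0r mulr0
    sub0r.
  have -> : (fun t => f t * (p t * cos (0 : R))) = fun t => f t * p t.
    by apply/funext => t; rewrite cos0 mulr1.
  have : (1 - 128^-1) * A <= avg s (fun t => f t * p t).
    rewrite -avgZ; apply: ler_avg => t; case/andP: (f01 t) => f0 _.
    have [/pV|/fV0->] := pselect (V t); last by rewrite mul0r mulr0.
    nra.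
  set Ap := avg s (fun t => f t * _); set Ar := avg s (fun t => f t * r (t, 0)).
  have ArA : Ar <= A.
    apply: ler_avg => t; case/andP: (f01 t) => f0 _;
      case/andP: (r1 (t, 0)) => _.
    nra.
  move=> Ap_ge rw; exists r; split => //.
    (* The functional is at most - 8 (1 - 1/128) A at [p] and larger by at most k / 8 <= A / 4 at
       [r]; now use Ar <= A. *)
    have : A * r (x, 0) <= A * 2^-1 by lra.
    by rewrite ler_pM2l.
  move=> y V'y yE; have /andP[_ ry1] := r1 (y, 0).
  have Ar_ge : k / 4 <= Ar.
    case/andP: (r1 (x, 0)) => rx1 _.
    have : - A <= A * r (x, 0) by rewrite -mulrN1 ler_pM2l.
    lra.
  (* The loss is 2 d from the near invariance of the average and d from the variation of [f]. *)
  have shift z : z = y \/ z = - y ->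
      Ar - 3 * d <= avg s (fun t => f t * r (t + z, 0)).
    move=> zy; have zs : z \in Y ++ [seq - y | y <- Y] ++ [seq - a | a <- F].
      have yY : y \in Y by apply/mapP; exists (y, 0).
      rewrite !mem_cat; case: zy => ->; first by rewrite yY.
      by rewrite (map_f (fun y => - y) yY) orbT.
    have fr1 t : `|f t * r (t, 0)| <= 1.
      rewrite normrM mulr_ile1 ?f1//; exact: state_norm rS.
    have := sP z zs _ _ fr1; rewrite ler_norml mulr1 -/Ar => /andP[Arz _].
    have : avg s (fun t => f (t + z) * r (t + z, 0)) - d <=
        avg s (fun t => f t * r (t + z, 0)).
      rewrite -(avg_cst d s0) -avgB; apply: ler_avg => t.
      have : `|f (t + z) - f t| <= d.
        case: zy => ->; first exact: fV.
        by rewrite distrC -[t in f t - _](subrK y) fV.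
      case/andP: (r1 (t + z, 0)) => r0 r1'; rewrite ler_norml => /andP[].
      nra.
    lra.
  (* D'Alembert's equation at (y, 0), averaged against [f]. *)
  have : avg s (fun t => f t * r (t + y, 0)) +
      avg s (fun t => f t * r (t + - y, 0)) = 2 * r (y, 0) * Ar.
    rewrite -avgD -avgZ; congr (avg s _); apply/funext => t.
    have := rE _ yE (t, 0).
    have -> : ((y, 0) + (t, 0) : G * R) = (t + y, 0).
      by congr (_, _); rewrite ?addr0 ?[y + t]addrC.
    have -> : ((y, 0) - (t, 0) : G * R) = - (t - y, 0).
      by congr (_, _); rewrite ?subr0 ?oppr0 ?opprB.
    by rewrite (stateN rS) -mulrDr => ->; ring.
  have := shift y (or_introl erefl); have := shift (- y) (or_intror erefl).
  move=> h1 h2 h3.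
  (* With Ar >= k / 4 and d <= k / 512, this yields 1 - r (y, 0) <= 3/128 < 1/32. *)
  have : (1 - r (y, 0)) * Ar <= 3 * d by lra.
  have : 3 * d <= 3 * (k / 512) by rewrite ler_pM2l.
  move=> n3 /le_trans/(_ n3) rAr.
  have : (1 - r (y, 0)) * (k / 4) <= 3 * (k / 512).
    by apply: le_trans rAr; rewrite ler_wpM2l// subr_ge0.
  nra.
have [|E g gE|r [rS rdA rle rge]] := @dalembert_limit _ _ (quarter_turn R G) r_.
- by move=> E; case: (r_P E).
- by case: (r_P E) => _ rE _ _; exact: rE.
have [chi chiB chir] := dalembert_character rS rdA.
exists (fun y => chi (y, 0)) => [y z|].
  by rewrite -chiB; congr (chi _); congr (_, _); rewrite subr0.
split => [y V'y|].
  have : 1 - 32^-1 <= r (y, 0).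
    apply: rge; apply: filterS (cofinal_seqs_sub [:: (y, 0)]) => E yE.
    by case: (r_P E) => _ _ _; apply => //; apply: yE; rewrite inE.
  by rewrite chir; lra.
have : r (x, 0) <= 2^-1.
  by apply: rle; apply: filterE => E; case: (r_P E).
by rewrite chir; lra.
Qed.

(** One character per translate a + W suffices: if it is far from 0 at one point of the translate
    outside [U], it stays away from 0 on the whole translate, being close to 0 on W - W. *)
Lemma character_nbhs U : N U -> exists l : seq (G -> circle R),
  (forall chi, chi \in l -> zmod_morphism chi /\
     forall O, nbhs (0 : circle R) O -> N (chi @^-1` O)) /\
  forall x, (forall chi, chi \in l -> 1 - ccos (chi x) < 8^-1) -> U x.
Proof.
move=> /separating_character[V NV VP].
have [W NW WV] := group_nbhsB NG NV.
have [F FW] := NF NW.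
have /choice[c cP] : forall a : G, exists chi : G -> circle R,
    [/\ zmod_morphism chi, forall y, V y -> 1 - ccos (chi y) <= 32^-1 &
      forall x, W (x - a) -> ~ U x -> 8^-1 <= 1 - ccos (chi x)].
  move=> a; have [[x0 [Wx0 nUx0]]|nx] := pselect (exists x, W (x - a) /\ ~ U x).
    have [chi chiB [chiV chix0]] := VP x0 nUx0; exists chi; split => // x Wx _.
    have := chiV _ (WV _ _ Wx0 Wx).
    have -> : x0 - a - (x - a) = x0 - x by rewrite opprB addrA subrK.
    move=> ccV; have := ccosDB (chi (x0 - x)) (chi x).
    rewrite -(zmod_morphD chiB) subrK; have := ccos_le1 (chi (x0 - x) - chi x).
    have := ccos_le1 (chi x); have := ccos_le1 (chi (x0 - x)).
    nra.
  exists (fun=> 0); split => [y z|y _|x Wx nUx]; first by rewrite subr0.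
    by rewrite ccos0 subrr invr_ge0.
  by case: nx; exists x.
exists [seq c a | a <- F]; split.
  move=> _ /mapP[a _ ->]; have [cB cV _] := cP a; split => //.
  apply: (near_character_continuous NV) => // y /cV.
  by move=> /le_trans; apply; rewrite invf_le1 ?ler1n.
move=> x xl; apply: contrapT => nUx; have [a aF Wxa] := FW x.
have [_ _ /(_ x Wxa nUx)] := cP a; rewrite leNgt => /negP; apply.
by apply: xl; exact: map_f.
Qed.

End precompact_duality.

(** * Duality for discrete groups *)

Lemma ccos_ge_half_nbhs (R : realType) :
  nbhs (0 : circle R) [set c | 2^-1 <= ccos c].
Proof.
have : nbhs (ccos (0 : circle R)) [set r : R | 2^-1 < r].
  by rewrite ccos0; apply: lt_nbhsr; rewrite invf_lt1 ?ltr1n.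
move=> /ccos_continuous; apply: (@filterS _ (nbhs (0 : circle R))) => c /=.
exact: ltW.
Qed.

Section bohr_neighbourhoods.
Variables (R : realType) (G : zmodType).
Implicit Types (H : set (G -> circle R)) (U : set G).

Definition bohr_nbhs H : set_system G :=
  [set U | exists (l : seq (G -> circle R)) (e : R),
    [/\ 0 < e, forall chi, chi \in l -> H chi &
      forall x, (forall chi, chi \in l -> 1 - ccos (chi x) < e) -> U x]].

#[global] Instance bohr_nbhs_filter H : Filter (bohr_nbhs H).
Proof.
split.
- by exists [::], 1.
- move=> U V [l [e [e0 lH lU]]] [l' [e' [e'0 lH' lV]]].
  exists (l ++ l'), (Num.min e e'); split; first by rewrite lt_min e0.
    by move=> chi; rewrite mem_cat => /orP[/lH|/lH'].
  move=> x xl; split; [apply: lU|apply: lV] => chi chil;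
    have := xl chi; rewrite mem_cat chil ?orbT => /(_ isT);
    by rewrite lt_min => /andP[].
- move=> U V UV [l [e [e0 lH lU]]]; exists l, e; split => // x /lU; exact: UV.
Qed.

Lemma bohr_nbhs_character H chi (O : set (circle R)) :
  H chi -> nbhs (0 : circle R) O -> bohr_nbhs H (chi @^-1` O).
Proof.
move=> Hchi /ccos_near0[e e0 eO]; exists [:: chi], e; split => //.
  by move=> psi; rewrite inE => /eqP->.
by move=> x /(_ chi (mem_head _ _)) /eO.
Qed.

End bohr_neighbourhoods.

Section topological_zmodule_facts.
Implicit Types G : topologicalZmodType.

Lemma nbhs0_shift G (x : G) (U : set G) :
  nbhs x U -> nbhs (0 : G) [set v | U (x + v)].
Proof.
move=> xU.
have : (fun v : G => x + v) @ nbhs (0 : G) --> x + 0.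
  apply: (@continuous_comp _ _ _ (fun v => (x, v))
    (fun z : G * G => z.1 + z.2) 0); last exact: add_continuous.
  by apply: (@cvg_pair _ _ _ _ (nbhs x) (nbhs (0 : G)));
    [exact: cvg_cst|exact: cvg_id].
by rewrite addr0; apply.
Qed.

Lemma nbhs_shift0 G (x : G) (V : set G) :
  nbhs (0 : G) V -> nbhs x [set y | V (y - x)].
Proof.
move=> V0.
have : (fun y : G => y - x) @ nbhs x --> x - x.
  apply: (@continuous_comp _ _ _ (fun y => (y, x))
    (fun z : G * G => z.1 - z.2) x); last exact: sub_continuous.
  by apply: (@cvg_pair _ _ _ _ (nbhs x) (nbhs x));
    [exact: cvg_id|exact: cvg_cst].
by rewrite subrr; apply.
Qed.

Lemma zmod_morphism_continuous G1 G2 (f : G1 -> G2) : zmod_morphism f ->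
  (forall U, nbhs (0 : G2) U -> nbhs (0 : G1) (f @^-1` U)) ->
  @continuous_map G1 G2 f.
Proof.
move=> fB f0 x U /nbhs0_shift/f0/(nbhs_shift0 x).
apply: (@filterS _ (nbhs x)) => y /=.
by rewrite fB addrC subrK.
Qed.

Lemma continuous_nbhs0 G1 (G2 : topologicalZmodType) (f : G1 -> G2) U :
  zmod_morphism f -> @continuous_map G1 G2 f ->
  nbhs (0 : G2) U -> nbhs (0 : G1) (f @^-1` U).
Proof. by move=> fB fc U0; apply: fc; rewrite (zmod_morph0 fB). Qed.

Lemma group_nbhs_nbhs0 G : group_nbhs (nbhs (0 : G)).
Proof.
split; first exact: nbhs_filter; first by move=> U /nbhs_singleton.
move=> U U0; have [[V W] /= [V0 W0] VW] : nbhs (0,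
  0 : G) [set z : G * G | U (z.1 - z.2)].
  by apply: (@sub_continuous G (0, 0)); rewrite /= subrr.
exists (V `&` W); first exact: filterI.
by move=> v w [Vv _] [_ Ww]; exact: (VW (v, w)).
Qed.

Lemma precompact_totally_bounded G :
  precompact_group G -> totally_bounded (nbhs (0 : G)).
Proof.
move=> Gp U /Gp[F /finite_seqP[s ->] GF]; exists s => x.
have : [set: G] x by [].
by rewrite GF => -[a /= aF [u Uu <-]]; exists a => //; rewrite addrC addKr.
Qed.

Lemma continuous_opens (X Y : topologicalType) (f : X -> Y) (U : set Y) :
  @continuous_map X Y f -> opens Y U -> opens X (f @^-1` U).
Proof. by move=> /continuousP fc; apply: fc. Qed.

End topological_zmodule_facts.

Section discrete_dual.
Variables (R : realType) (A : zmodType).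
Local Notation K := (dual R (discrete_topology A)).
Implicit Types (chi : K) (H : set K).

Lemma dual_morphism (G : topologicalZmodType) (x : dual R G) : zmod_morphism x.
Proof. by have /set_mem[] := dual_funP x. Qed.

Lemma dual_continuous (G : topologicalZmodType) (x : dual R G) : continuous x.
Proof. by have /set_mem[] := dual_funP x. Qed.

Lemma discrete_continuous (Y : topologicalType) (f : A -> Y) :
  @continuous_map (discrete_topology A) Y f.
Proof.
by move=> x U /nbhs_singleton Ux; apply: filterS (discrete_set1 _) => _ ->.
Qed.

Lemma discrete_character (chi : A -> circle R) : zmod_morphism chi ->
  exists c : K, c = chi :> (A -> circle R).
Proof.
move=> chiB; have chiP : (chi : discrete_topology A -> circle R) \in
    @characters R (discrete_topology A).
  by apply/mem_set; split => //; exact: discrete_continuous.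
by exists (Dual chiP).
Qed.

Definition as_functions H : set (A -> circle R) :=
  [set chi : A -> circle R | exists2 c : K, H c & c = chi :> (A -> circle R)].

Lemma tau_nbhs0 H (U : set A) :
  @nbhs _ (tau H) (0 : tau H) U -> bohr_nbhs (as_functions H) U.
Proof.
suff Bcvg : bohr_nbhs (as_functions H) --> (0 : tau H) by move/Bcvg.
apply/cvg_sup => -[chi Hchi] V /= [_ [[W oW <-] /= W0 WV]].
apply: filterS WV _; apply: bohr_nbhs_character; first by exists chi.
by rewrite -(zmod_morph0 (@dual_morphism _ chi)); exact: open_nbhs_nbhs.
Qed.

Lemma tau_precompact H : precompact_group (tau H).
Proof.
move=> U /tau_nbhs0[l [e [e0 lH lU]]].
have [|F FP] := @bohr_cover _ _ l e e0 _ setT.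
  by move=> chi /lH[c _ <-]; exact: (dual_morphism c).
exists [set` F] => //; first exact: finite_seq.
rewrite eqEsubset; split => // x _; have [a [aF _ xa]] := FP x I.
by exists a => //; exists (x - a); [exact: lU|rewrite addrC subrK].
Qed.

(** Points of a discrete group are open, so on its compact subsets uniform control reduces to
    finitely many evaluations. *)
Lemma dual_nbhs0 (U : set K) : nbhs (0 : K) U ->
  bohr_nbhs [set psi | exists a : A, psi = fun chi : K => chi a] U.
Proof.
set B := bohr_nbhs _.
move=> [_ [[C oC <-] /= C0 CU]].
suff Bcvg : (fun chi : K => (dual_fun chi : {compact-open,
  discrete_topology A -> circle R}))
    @ B --> (dual_fun (0 : K) : {compact-open,
      discrete_topology A -> circle R}).
  have nC : nbhs (dual_fun (0 : K) : {compact-open,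
    discrete_topology A -> circle R}) C.
    exact: open_nbhs_nbhs.
  by apply: filterS CU _; exact: (Bcvg C nC).
apply/compact_open_cvgP => D O cD oO DO.
have : \forall chi \near B, D `<=` [set x | O ((chi : K) x)].
  have /compact_near_coveringP/near_covering_withinP cov := cD.
  apply: (cov _ B (fun chi : K => [set x | O (chi x)])) => x Dx.
  exists ([set x], [set chi : K | O (chi x)]) => /=.
    split; first exact: discrete_set1.
    apply: (@bohr_nbhs_character _ _ _ (fun chi : K => chi x));
      first by exists x.
    by apply: open_nbhs_nbhs; split => //; apply: DO; exists x.
  by move=> [_ chi] [/= -> ].
by apply: filterS => chi chiO _ [x Dx <-]; exact: chiO.
Qed.

(** The evaluations form a group of characters of [K], and [x] is close to 0 on one of their Bohr
    sets; [bohr_character] makes [x] an evaluation. *)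
Lemma dual_discrete_evaluation (x : dual R K) :
  exists a : A, forall chi : K, x chi = chi a.
Proof.
have x0 : nbhs (0 : K) (x @^-1` [set c | 2^-1 <= ccos c]).
  apply: (continuous_nbhs0 (dual_morphism x) (@dual_continuous _ x)).
  exact: ccos_ge_half_nbhs.
have [l [e [e0 lS lx]]] := dual_nbhs0 x0.
have [|||||a ax] := @bohr_character _ _
  [set psi | exists a : A, psi = fun chi : K => chi a] l e x _ _ _ lS e0.
- by move=> _ [a ->].
- exists 0; apply/funext => chi.
  by rewrite (zmod_morph0 (dual_morphism chi)).
- move=> _ _ [a ->] [b ->]; exists (a - b); apply/funext => chi.
  by rewrite (dual_morphism chi).
- exact: dual_morphism.
- exact: lx.
by exists a => chi; rewrite ax.
Qed.

Lemma evaluation_continuous (a : A) :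
  continuous (fun chi : K => chi a : circle R).
Proof.
move=> chi U; rewrite nbhsE => -[V [oV Va] VU].
have ca : compact [set a : discrete_topology A] by exact: compact_set1.
have := @dual_nbhs R (discrete_topology A) chi [set a] V ca oV _.
by move=> /(_ (fun _ => _)) H; apply: filterS (H _) => [psi|_ ->//];
  move=> /(_ a erefl)/VU.
Qed.

Lemma evaluation_exists : exists ev : A -> dual R K,
  zmod_morphism ev /\ forall a (chi : K), ev a chi = chi a.
Proof.
have evP a : (fun chi : K => chi a : circle R) \in @characters R K.
  by apply/mem_set; split => // ; exact: evaluation_continuous.
exists (fun a => Dual (evP a)); split => // a b.
by apply/val_inj/funext => chi /=; rewrite (dual_morphism chi).
Qed.

(** The inverse is additive because characters separate the points of [A]. *)
Lemma evaluation_inverse : exists inv : dual R K -> A,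
  zmod_morphism inv /\ forall (x : dual R K) (chi : K), x chi = chi (inv x).
Proof.
have /choice[inv invP] := dual_discrete_evaluation.
exists inv; split => // x y; apply/eqP; rewrite -subr_eq0; apply/negPn/negP.
move=> /(character_separation R)[psi psiB];
  have [chi <-] := discrete_character psiB.
apply; rewrite !(dual_morphism chi) -!invP.
by rewrite subrr.
Qed.

(** By continuity, the cosine of [chi] is at least 1/2 on a Bohr set of [H], so [bohr_character]
    applies. *)
Lemma tau_continuous_character H chi : zmod_closed (mem H) ->
  @continuous_map (tau H) (circle R) chi -> H chi.
Proof.
move=> [H0 HB] chic.
have x0 : nbhs (0 : tau H) (chi @^-1` [set c | 2^-1 <= ccos c]).
  apply: (@continuous_nbhs0 (tau H) _ _ _ (dual_morphism chi) chic).
  exact: ccos_ge_half_nbhs.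
have [l [e [e0 lS lx]]] := tau_nbhs0 x0.
have [|||||c Hc cchi] := @bohr_character _ _ (as_functions H) l e chi _ _ _ lS
  e0.
- by move=> _ [c _ <-]; exact: (dual_morphism c).
- by exists 0 => //; exact: set_mem H0.
- move=> _ _ [c Hc <-] [d Hd <-]; exists (c - d) => //.
  by apply/set_mem/HB; exact: mem_set.
- exact: (dual_morphism chi).
- exact: lx.
by suff <- : c = chi by []; apply: val_inj; exact: cchi.
Qed.

End discrete_dual.

(** * The closure operator and k-groups *)

Lemma bohr_nbhs_sub (R : realType) (G : zmodType) (H : set (G -> circle R))
    (N : set_system G) : Filter N ->
  (forall chi, H chi -> forall O, nbhs (0 : circle R) O -> N (chi @^-1` O)) ->
  bohr_nbhs H `<=` N.
Proof.
move=> FN HN U [l [e [e0 lH lU]]]; apply: filterS lU _.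
elim: l lH => [_|chi l IHl lH]; first by apply: filterE.
have {}IHl : N [set x | forall chi, chi \in l -> 1 - ccos (chi x) < e].
  by apply: IHl => psi psil; apply: lH; rewrite inE psil orbT.
have nearC : nbhs (0 : circle R) [set c | 1 - ccos c < e].
  have /ccos_continuous : nbhs (ccos (0 : circle R)) [set r | 1 - e < r].
    by apply: lt_nbhsr; rewrite ccos0 gtrBl.
  by apply: (@filterS _ (nbhs (0 : circle R))) => c /=; lra.
have /HN/(_ _ nearC) chiN : H chi by apply: lH; rewrite inE eqxx.
apply: filterS2 IHl chiN => x xl chix psi.
by rewrite inE => /predU1P[->|]; [exact: chix|exact: xl].
Qed.

(** * Presentation of a precompact group by its continuous characters *)

Section precompact_presentation.
Variables (R : realType) (X : topologicalZmodType).
Hypothesis Xp : precompact_group X.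
Local Notation H := (continuous_characters R X).

Lemma precompact_nbhs0 (U : set X) :
  nbhs (0 : X) U -> bohr_nbhs (as_functions H) U.
Proof.
move=> /(character_nbhs R (group_nbhs_nbhs0 X) (precompact_totally_bounded Xp)).
move=> [l [lP lU]]; exists l, 8^-1; split => //; first by rewrite invr_gt0.
move=> chi /lP[chiB chic]; have [c cchi] := discrete_character chiB.
by exists c => //; rewrite /continuous_characters /= cchi;
  exact: zmod_morphism_continuous.
Qed.

Lemma continuous_characters_zmod_closed : zmod_closed (mem H).
Proof.
split.
  by apply/mem_set; exact: cst_continuous.
move=> f g /set_mem fc /set_mem gc; apply/mem_set => x.
apply: (@continuous_comp X _ _ (fun x => (f x, g x))
  (fun z : circle R * circle R => z.1 - z.2)); last exact: sub_continuous.
by apply: (@cvg_pair _ _ _ _ (nbhs (f x)) (nbhs (g x))); [exact: fc|exact: gc].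
Qed.

Lemma precompact_tau_continuous : @continuous_map (tau H) X id.
Proof.
apply: zmod_morphism_continuous => // U /precompact_nbhs0.
apply: bohr_nbhs_sub => chi [c Hc <-] O O0.
exact: (@continuous_nbhs0 (tau H) _ c O (dual_morphism c)
  (tau_character_continuous Hc)).
Qed.

Lemma precompact_presented : presented_by R X H.
Proof.
split; first exact: continuous_characters_zmod_closed.
rewrite eqEsubset; split => U; first exact: continuous_opens
  precompact_tau_continuous.
by apply: (@continuous_opens X (tau H) id); apply: tau_coarsest.
Qed.

Lemma presented_by_unique (L : set (dual R (discrete_topology X))) :
  presented_by R X L -> L = H.
Proof.
move=> [Lz XL]; rewrite eqEsubset; split => chi.
  move=> Lchi; apply/continuousP => U oU.
  change (opens X (chi @^-1` U)); rewrite XL.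
  exact: continuous_opens (tau_character_continuous Lchi) oU.
move=> chic; apply: tau_continuous_character Lz _; apply/continuousP => U oU.
change (opens (tau L) (chi @^-1` U)); rewrite -XL.
exact: (@continuous_opens X _ _ _ chic oU).
Qed.

End precompact_presentation.

Lemma base_cvg_image (X Y : topologicalType) (f : X -> Y) (F : set_system X)
    (x : X) :
  @continuous_map X Y f -> base_cvg F x -> base_cvg (base_image f F) (f x).
Proof.
move=> fc Fx U /fc/Fx[A FA AU]; exists (f @` A); first by exists A.
by move=> _ [y Ay <-]; exact: AU.
Qed.

Lemma base_cvg_tau (R : realType) (A : zmodType)
    (L : set (dual R (discrete_topology A))) (F : set_system A) :
  filter_base F ->
  (forall chi, L chi -> base_cvg (base_image chi F) (0 : circle R)) ->
  @base_cvg (tau L) F 0.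
Proof.
move=> [[B FB] F0 FI] FL.
have FF : Filter (filter_from F id).
  apply: filter_from_filter; first by exists B.
  by move=> C D /FI/[apply].
apply/cvg_sup => -[chi Lchi] U /= [_ [[V oV <-] /= V0 VU]].
have [|_ [C FC <-] CV] := FL chi Lchi V.
  rewrite -(zmod_morph0 (dual_morphism chi)); exact: open_nbhs_nbhs.
by exists C => // x Cx; apply: VU; apply: CV; exists x.
Qed.

Lemma topological_group_div (C : topologicalGroupType) (O : set C) :
  nbhs (1%g : C) O ->
  exists2 V, nbhs (1%g : C) V & forall v w, V v -> V w -> O (v * w^-1)%g.
Proof.
move=> O1; have : nbhs (1%g : C, 1%g : C) [set z : C * C | O (z.1 * z.2^-1)%g].
  have : (fun z : C * C => z.1 * z.2^-1)%g @ nbhs (1%g : C,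
    1%g : C) --> (1 * 1^-1 : C)%g.
    apply: (@continuous_comp _ _ _ (fun z : C * C => (z.1, z.2^-1)%g)
      (fun z : C * C => z.1 * z.2)%g (1%g, 1%g)); last exact: mulg_continuous.
    apply: (@cvg_pair _ _ _ _ (nbhs (1%g : C)) (nbhs (1^-1 : C)%g)).
      exact: cvg_fst.
    exact: (@cvg_comp _ _ _ snd (fun x : C => x^-1%g) _ _ _ cvg_snd
      (@invg_continuous C 1%g)).
  by rewrite invg1 mulg1; apply.
move=> [[V W] /= [V1 W1] VW]; exists (V `&` W); first exact: filterI.
by move=> v w [Vv _] [_ Ww]; exact: (VW (v, w)).
Qed.

Lemma topological_group_shift (C : topologicalGroupType) (c d : C) (U : set C) :
  nbhs (c * d)%g U -> nbhs c [set x | U (x * d)%g].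
Proof.
suff : (fun x : C => x * d)%g @ nbhs c --> (c * d)%g by apply.
apply: (@continuous_comp _ _ _ (fun x => (x,
  d)) (fun z : C * C => z.1 * z.2)%g c).
  by apply: (@cvg_pair _ _ _ _ (nbhs c) (nbhs d));
    [exact: cvg_id|exact: cvg_cst].
exact: mulg_continuous.
Qed.

(** * The group topology induced by a homomorphism into a compact group *)

Section compact_image.
Variables (A : zmodType) (C : topologicalGroupType) (phi : A -> C).
Hypotheses (Ccompact : compact [set: C])
  (phiD : {morph phi : x y / x + y >-> (x * y)%g}).

Definition pullback_nbhs : set_system A :=
  [set U | exists2 O, nbhs (1%g : C) O & phi @^-1` O `<=` U].

Let phi0 : phi 0 = 1%g.
Proof. by apply: (mulgI (phi 0)); rewrite -phiD addr0 mulg1. Qed.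

Let phiN x : phi (- x) = (phi x)^-1%g.
Proof. by apply: (mulgI (phi x)); rewrite -phiD subrr mulgV. Qed.

Lemma pullback_group_nbhs : group_nbhs pullback_nbhs.
Proof.
split.
- split; first by exists setT => //; exact: filterT.
    move=> U V [O O1 OU] [O' O'1 OV]; exists (O `&` O'); first exact: filterI.
    by move=> x [Ox O'x]; split; [exact: OU|exact: OV].
  by move=> U V UV [O O1 OU]; exists O => // x /OU/UV.
- by move=> U [O /nbhs_singleton O1]; apply; rewrite /= phi0.
- move=> U [O /topological_group_div[V V1 VO] OU].
  exists (phi @^-1` V); first by exists V.
  by move=> v w Vv Vw; apply: OU; rewrite /= phiD phiN; exact: VO.
Qed.

(** Finitely many translates of [V] cover [C], and each one that meets the image receives a centre
    in it. The covering property is vacuous off the image, which need not be closed. *)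
Lemma pullback_totally_bounded : totally_bounded pullback_nbhs.
Proof.
move=> U [O /topological_group_div[V V1 VO] OU].
have /compact_near_coveringP := Ccompact.
move=> /(_ (seq A) (@cofinal_seqs A) (fun E c => forall x, phi x = c ->
  exists2 a, a \in E & O (c * (phi a)^-1)%g) _).
case=> [c _|E EP].
  have cV : nbhs c [set d | V (d * c^-1)%g].
    by apply: topological_group_shift; rewrite mulgV.
  have [[a Va]|nV] := pselect (exists a, V (phi a * c^-1)%g).
    exists ([set d | V (d * c^-1)%g], [set E : seq A | {subset [:: a] <= E}]).
      by split => //; exact: cofinal_seqs_sub.
    move=> [d E] [/= Vd aE] x _; exists a; first by apply: aE; rewrite inE.
    by have := VO _ _ Vd Va; rewrite mulgKA.
  exists ([set d | V (d * c^-1)%g], setT); first by split => //; exact: filterT.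
  by move=> [d E] [/= Vd _] x xd; case: nV; exists x; rewrite xd.
exists E => x; have [a aE Oa] := EP E (fun=> leqnn _) (phi x) I x erefl.
by exists a => //; apply: OU; rewrite /= phiD phiN.
Qed.

End compact_image.

(* k_group only considers codomains written multiplicatively. *)
Definition mul_circle (R : realType) : Type := circle R.

HB.instance Definition _ (R : realType) :=
  Topological.copy (mul_circle R) (circle R).
HB.instance Definition _ (R : realType) := isGroup.Build (mul_circle R)
  (@addrA (circle R)) (@add0r (circle R)) (@addr0 (circle R))
  (@addNr (circle R)) (@subrr (circle R)).
HB.instance Definition _ (R : realType) :=
  isTopologicalGroup.Build (mul_circle R)
    (@add_continuous (circle R)) (@opp_continuous (circle R)).

(** * The closure as the group of T-continuous characters, and the closed topologies *)

Section regular_continuity_type.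
Variables (R : realType) (T : continuity_type) (hT : regular_ct T).

Section closure.
Variable X : topologicalZmodType.
Local Notation K := (dual R (discrete_topology X)).
Implicit Types (H : set K) (chi : K).

(** The closure is defined by filter bases on the bidual; [ev] carries [F] there, and regularity
    dispenses with its continuity on [X]. [ct_closureP] goes back along the inverse. *)
Lemma ct_closure_cvg H chi (F : set_system X) : ct_closure R T K H chi -> T X F
  ->
  (forall psi, H psi -> base_cvg (base_image psi F) (0 : circle R)) ->
  base_cvg (base_image chi F) (0 : circle R).
Proof.
move=> Hchi TF HF; have [ev [evB evE]] := evaluation_exists R X.
have evF (psi : K) : base_image (fun x : dual R K => x psi) (base_image ev F) =
    base_image psi F.
  by rewrite -base_image_comp; congr (base_image _ F); apply/funext => a /=.
have := Hchi (base_image ev F); rewrite /zset /= evF; apply; split.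
  exact: (regular_image hT evB TF).
by move=> psi Hpsi /=; rewrite evF; exact: HF.
Qed.

Lemma ct_closureP H chi :
  (forall F, T X F ->
     (forall psi, H psi -> base_cvg (base_image psi F) (0 : circle R)) ->
     base_cvg (base_image chi F) (0 : circle R)) ->
  ct_closure R T K H chi.
Proof.
move=> chiF F [TF HF]; have [inv [invB invE]] := @evaluation_inverse R X.
have invF (psi : K) : base_image psi (base_image inv F) =
    base_image (fun x : dual R K => x psi) F.
  by rewrite -base_image_comp; congr (base_image _ F); apply/funext => x /=.
rewrite /zset /= -invF; apply: chiF; first exact: (regular_image hT invB TF).
by move=> psi /HF; rewrite invF.
Qed.

Lemma sub_ct_closure H : H `<=` ct_closure R T K H.
Proof. by move=> chi Hchi F [_]; apply. Qed.

Lemma ct_closure_base_cvg H (F : set_system X) : T X F ->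
  (forall psi, H psi -> base_cvg (base_image psi F) (0 : circle R)) ->
  @base_cvg (tau (ct_closure R T K H)) F 0.
Proof.
move=> TF HF; apply: base_cvg_tau; first exact: ct_filter_base TF.
by move=> chi Hchi; exact: ct_closure_cvg Hchi TF HF.
Qed.

Lemma regular_tau H (F : set_system X) : T (tau H) F = T X F.
Proof.
rewrite propeqE; split => TF.
  by rewrite -(base_image_id F); apply: (@regular_image _ hT (tau H) X id).
by rewrite -(base_image_id F); apply: (@regular_image _ hT X (tau H) id).
Qed.

End closure.

Lemma character_image_cvg (X : topologicalZmodType) (F : set_system X)
    (chi : dual R (discrete_topology X)) :
  continuous_characters R X chi -> base_cvg F (0 : X) ->
  base_cvg (base_image chi F) (0 : circle R).
Proof.
move=> chic F0; rewrite -(zmod_morph0 (dual_morphism chi)).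
exact: (@base_cvg_image X _ chi F 0 chic F0).
Qed.

Lemma f_group_id_continuous (X : precompact_ab) :
  @continuous_map (f_group T R X) X id.
Proof.
move=> x; apply: (@continuous_comp (f_group T R X)
  (tau (continuous_characters R X)) X id id x).
  apply: tau_coarsest => chi Hchi.
  by apply: tau_character_continuous; exact: sub_ct_closure.
exact: (precompact_tau_continuous (@pr_precompact X)).
Qed.

Lemma f_group_id_ct_continuous (X : precompact_ab) :
  @ct_continuous T X (f_group T R X) 0 id.
Proof.
move=> F TF F0; rewrite base_image_id; apply: ct_closure_base_cvg => // psi
  psic.
exact: character_image_cvg.
Qed.

Lemma f_group_precompact (X : precompact_ab) : precompact_group (f_group T R X).
Proof. exact: tau_precompact. Qed.

(** For psi in the closed subgroup of [Y], the composite of psi with [phi] satisfies the criterion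
    of [ct_closureP] for [X]. *)
Lemma f_group_continuous (X Y : precompact_ab) (phi : X -> Y) :
  zmod_morphism phi -> ct_continuous T (0 : Y) phi ->
  @continuous_map (f_group T R X) (f_group T R Y) phi.
Proof.
move=> phiB phic; apply: tau_coarsest => psi Hpsi.
have [chi chiE] : exists chi : dual R (discrete_topology X),
    chi = psi \o phi :> (X -> circle R).
  apply: discrete_character; exact: zmod_morphism_comp (dual_morphism psi) phiB.
rewrite -chiE; apply: tau_character_continuous; apply: ct_closureP => F TF HF.
rewrite chiE base_image_comp; apply: (ct_closure_cvg Hpsi).
  exact: regular_image TF.
move=> c cc; apply: character_image_cvg => //; apply: phic => //.
(* Convergence along all continuous characters is convergence to 0 in [X], as [X] is precompact. *)
have := @base_cvg_tau R X (continuous_characters R X) F (ct_filter_base TF) HF.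
move=> /(base_cvg_image (precompact_tau_continuous (@pr_precompact X))).
by rewrite base_image_id.
Qed.

(** The topology pulled back along [phi] is totally bounded, hence controlled by characters. These
    inherit T-continuity from [phi], so they lie in the closure and are continuous on
    [f_group T R X]. *)
Lemma f_group_k_group (X : precompact_ab) : k_group T (f_group T R X).
Proof.
move=> C phi Ccompact _ phiD phic.
pose A : zmodType := X.
have NG := @pullback_group_nbhs A C phi phiD.
have NF := @pullback_totally_bounded A C phi Ccompact phiD.
have phi0 U : nbhs (1%g : C) U -> nbhs (0 : f_group T R X) (phi @^-1` U).
  move=> U1; have [|l [lP lU]] := @character_nbhs R _ _ NG NF (phi @^-1` U).
    by exists U.
  apply: (@bohr_nbhs_sub R A (as_functions (ct_closure R T _
    (continuous_characters R X)))).
    move=> chi [c Hc <-] O O0.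
    exact: (@continuous_nbhs0 (f_group T R X) _ c O (dual_morphism c)
      (tau_character_continuous Hc)).
  exists l, 8^-1; split; [by rewrite invr_gt0| |exact: lU].
  move=> chi /lP[chiB chiN]; have [c cchi] := discrete_character chiB.
  exists c => //; apply: ct_closureP => F TF HF.
  have := phic F; rewrite regular_tau => /(_ TF (ct_closure_base_cvg TF HF))
    phiF.
  move=> O /chiN[O' /phiF[_ [B FB <-] BO'] O'O].
  exists (c @` B); first by exists B.
  by move=> _ [x Bx <-]; rewrite cchi; apply: O'O; apply: BO'; exists x.
move=> x U xU.
have : nbhs (1%g : C) [set c | U (c * phi x)%g].
  by apply: topological_group_shift; rewrite mul1g.
move=> /phi0/(nbhs_shift0 (x : f_group T R X)).
apply: (@filterS _ (nbhs (x : f_group T R X))) => y /=.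
by rewrite -phiD subrK.
Qed.

(** Characters in the closed subgroup of [Y], composed with [phi], are T-continuous maps into the
    compact circle, hence continuous on the k-group [X]. *)
Lemma k_group_continuous (X : topologicalZmodType) (Y : precompact_ab)
    (phi : X -> Y) :
  k_group T X -> zmod_morphism phi -> ct_continuous T (0 : Y) phi ->
  @continuous_map X (f_group T R Y) phi.
Proof.
move=> Xk phiB phic; apply: tau_coarsest => psi Hpsi.
apply: (Xk (mul_circle R) ((psi : Y -> circle R) \o phi)).
- exact: circle_compact.
- exact: circle_hausdorff.
- move=> x y /=; rewrite (zmod_morphD phiB).
  exact: (zmod_morphD (dual_morphism psi)).
- move=> F TF F0; rewrite base_image_comp.
  apply: (ct_closure_cvg Hpsi); first exact: regular_image TF.
  by move=> c cc; apply: character_image_cvg => //; exact: phic.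
Qed.

End regular_continuity_type.

(** * The functor *)

(** The quasi-inverse is the inclusion, and all components are identity maps: X and [f_group T R X]
    are isomorphic by T-continuous maps, and by continuous ones when X is a k-group. *)
Lemma f_group_equivalence (R : realType) (T : continuity_type) (hT : regular_ct
  T)
    (f_precompact : forall X : precompact_ab, precompact_group (f_group T R X))
    (f_k_group : forall X : precompact_ab, k_group T (f_group T R X))
    (f_continuous : forall (X Y : precompact_ab) (phi : X -> Y),
       zmod_morphism phi -> ct_continuous T (0 : Y) phi ->
       @continuous_map (f_group T R X) (f_group T R Y) phi) :
  equivalence_of_categories (f_functor hT f_precompact f_k_group f_continuous).
Proof.
set f := f_functor _ _ _ _.
exists (functor_comp (PrAb_PrT hT) (TkPrAb_PrAb T)); split.
  have etaP (X : precompact_ab) : @zmod_morphism (f_group T R X) X id /\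
      @ct_continuous T (f_group T R X) X (0 : X) id.
    split => //; apply: continuous_ct_continuous => //.
    exact: f_group_id_continuous.
  exists (fun X => exist _ id (etaP X)); split.
    by move=> X Y phi; exact: sig_prop_inj.
  move=> X; have invP : @zmod_morphism X (f_group T R X) id /\
      @ct_continuous T X (f_group T R X) 0 id.
    by split => //; exact: f_group_id_ct_continuous.
  by exists (exist _ id invP); split; exact: sig_prop_inj.
have etaP (X : TkPrAb T) : @zmod_morphism (f_group T R (sval X)) (sval X) id /\
    @continuous_map (f_group T R (sval X)) (sval X) id.
  by split => //; exact: f_group_id_continuous.
exists (fun X => exist _ id (etaP X)); split.
  by move=> X Y phi; exact: sig_prop_inj.
move=> X; have invP : @zmod_morphism (sval X) (f_group T R (sval X)) id /\
    @continuous_map (sval X) (f_group T R (sval X)) id.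
  split => //; apply: (k_group_continuous hT (svalP X)) => // F TF.
  by rewrite base_image_id.
by exists (exist _ id invP); split; exact: sig_prop_inj.
Qed.

(** The bijection keeps the underlying map: on a k-group, continuity into Y and into [f_group T R Y]
    are equivalent. *)
Lemma f_group_coreflection (R : realType) (T : continuity_type) (hT :
  regular_ct T)
    (f_precompact : forall X : precompact_ab, precompact_group (f_group T R X))
    (f_k_group : forall X : precompact_ab, k_group T (f_group T R X))
    (f_continuous : forall (X Y : precompact_ab) (phi : X -> Y),
       zmod_morphism phi -> ct_continuous T (0 : Y) phi ->
       @continuous_map (f_group T R X) (f_group T R Y) phi) :
  right_adjoint_to
    (functor_comp (f_functor hT f_precompact f_k_group f_continuous) (PrAb_PrT
      hT))
    (TkPrAb_PrAb T).
Proof.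
have toP (X : TkPrAb T) (Y : precompact_ab) (phi : PrAb_hom (sval X) Y) :
    zmod_morphism (sval phi) /\
    @continuous_map (sval X) (f_group T R Y) (sval phi).
  case: phi => phi [phiB phic] /=; split => //.
  apply: (k_group_continuous hT (svalP X)) => //.
  exact: continuous_ct_continuous.
exists (fun X Y phi => exist _ (sval phi) (toP X Y phi)); split.
  move=> X Y.
  have ofP (phi : PrAb_hom (sval X) (PrecompactAb (@f_precompact Y))) :
      @zmod_morphism (sval X) Y (sval phi) /\ @continuous_map (sval X) Y (sval
        phi).
    case: phi => phi [phiB phic] /=; split => //.
    move=> x; apply: (@continuous_comp (sval X) (f_group T R Y) Y phi id x).
      exact: phic.
    exact: f_group_id_continuous.
  exists (fun phi => exist _ (sval phi) (ofP phi)) => phi; exact: sig_prop_inj.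
by move=> X X' Y Y' h k phi; exact: sig_prop_inj.
Qed.

(** The first part ties [f_group] to every presentation (A, tau_H); the existential quantifiers
    supply the facts from which [f_functor] is built. *)
Theorem theorem2p14 (R : realType) (T : continuity_type) (hT : regular_ct T) :
  (forall X : precompact_ab,
     presented_by R X (continuous_characters R X) /\
     forall H : set (dual R (discrete_topology X)), presented_by R X H ->
       opens (f_group T R X) =
       opens (tau (ct_closure R T (dual R (discrete_topology X)) H))
       :> set (set X)) /\
  exists (f_precompact : forall X : precompact_ab,
            precompact_group (f_group T R X))
         (f_k_group : forall X : precompact_ab, k_group T (f_group T R X))
         (f_continuous : forall (X Y : precompact_ab) (phi : X -> Y),
            zmod_morphism phi -> ct_continuous T (0 : Y) phi ->
            @continuous_map (f_group T R X) (f_group T R Y) phi),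
    let f : functor (PrT hT) (TkPrAb T) :=
      f_functor hT f_precompact f_k_group f_continuous in
    equivalence_of_categories f /\
    right_adjoint_to (functor_comp f (PrAb_PrT hT)) (TkPrAb_PrAb T).
Proof.
split=> [X|].
  split=> [|H XH]; first exact: precompact_presented (@pr_precompact X).
  by rewrite (presented_by_unique XH).
exists (@f_group_precompact R T), (f_group_k_group hT), (f_group_continuous hT).
split; [exact: f_group_equivalence|exact: f_group_coreflection].
Qed.
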